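(* Let $G$ be a faithful weakly hyperbolic group that is not lim-free. If the transitivity degree of $G$ is $3$, then for any general type action of $G$ on any hyperbolic space $S$, if the induced action of $G$ on $\Lambda_S(G)$ is faithful, then it is topologically $3$-transitive.
   Context: A hyperbolic space is a geodesic metric space $S$ (not assumed proper) such that for some $\delta\ge 0$, $\langle x|y\rangle_o\ge\min\{\langle x|z\rangle_o,\langle z|y\rangle_o\}-\delta$ for all $x,y,z,o\in S$, where $\langle x|y\rangle_o=\frac12(d(x,o)+d(y,o)-d(x,y))$. Its Gromov boundary $\partial S$ is the set of equivalence classes of sequences $(x_i)$ in $S$ with $\langle x_i|x_j\rangle_o\to\infty$ as $i,j\to\infty$, where $(x_i)\sim(y_i)$ iff $\langle x_i|y_j\rangle_o\to\infty$; a sequence in the class $a$ is said to converge to $a$. For $a,b\in\partial S$, $\langle a|b\rangle_o$ is the infimum of $\liminf_{i,j}\langle x_i|y_j\rangle_o$ over sequences $x_i\to a$, $y_j\to b$; $\partial S$ is topologized so that the sets $\{b\in\partial S:\langle a|b\rangle_o>r\}$, $r\ge 0$, form a neighborhood base at $a$. All group actions on hyperbolic spaces are by isometries; they extend to actions by homeomorphisms on $\partial S$. The limit set $\Lambda_S(G)\subseteq\partial S$ of a group $G$ acting on $S$ is the set of points of $\partial S$ that are limits of sequences in an orbit $Gs$ (independent of $s\in S$), with the subspace topology. An element $g\in G$ is loxodromic if $\langle g\rangle$ has unbounded orbits in $S$ and fixes exactly two points of $\partial S$. The action of $G$ on $S$ is of general type if its orbits are unbounded and $G$ contains two loxodromic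 elements with disjoint fixed point sets in $\partial S$. An action by homeomorphisms on a topological space $X$ is topologically free if for every nontrivial element $g$ the set of fixed points of $g$ in $X$ has empty interior. A group is faithful weakly hyperbolic if it admits a general type action on a hyperbolic space such that the induced action on the limit set is faithful. It is lim-free if it admits a general type action on a hyperbolic space such that the induced action on the limit set is topologically free. An action of $G$ on a set $\Omega$ is $k$-transitive if for any two $k$-tuples of distinct points $(\omega_1,\dots,\omega_k)$, $(v_1,\dots,v_k)$ of $\Omega$ there is $g\in G$ with $g\omega_i=v_i$ for all $i$. The transitivity degree of $G$ is the maximum (or supremum, possibly $\infty$) of those $k\in\mathbb N$ such that $G$ admits a $k$-transitive faithful action on some set. An action of $G$ on a topological space $X$ is topologically transitive if for all nonempty open $U,V\subseteq X$ there is $g\in G$ with $gU\cap V\neq\emptyset$; it is topologically $k$-transitive if the induced diagonal action on $X^k$ is topologically transitive. *)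

(* Defs.v *)
From HB Require Import structures.
From mathcomp Require Import all_boot all_order all_algebra.
From mathcomp Require Import all_classical all_reals all_analysis.
From mathcomp Require Import lra.

Set Implicit Arguments.
Unset Strict Implicit.
Unset Printing Implicit Defensive.
Import Order.TTheory GRing.Theory Num.Theory.
Import numFieldNormedType.Exports.
Local Open Scope classical_set_scope.
Local Open Scope ring_scope.

Section Actions.
Variable G : groupType.

Record group_action (X : Type) := GroupAction {
  act :> G -> X -> X;
  act1 : forall x, act 1%g x = x;
  actM : forall g h x, act (g * h)%g x = act g (act h x)
}.

Lemma actK X (a : group_action X) g : cancel (a g) (a g^-1%g).
Proof. by move=> x; rewrite -actM mulVg act1. Qed.

Definition fixed_points X (a : group_action X) (g : G) : set X :=
  [set x | a g x = x].

Definition faithful_action X (a : group_action X) :=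
  forall g, (forall x, a g x = x) -> g = 1%g.

Definition k_transitive (k : nat) X (a : group_action X) :=
  forall w v : 'I_k -> X, injective w -> injective v ->
    exists g, forall i, a g (w i) = v i.

Definition topologically_free (X : topologicalType) (a : group_action X) :=
  forall g, g != 1%g -> interior (fixed_points a g) = set0.

Definition topologically_transitive (X : topologicalType)
    (a : group_action X) :=
  forall U V : set X, open U -> open V -> U !=set0 -> V !=set0 ->
    exists g, (a g @` U) `&` V !=set0.

Section Diagonal.
Variables (k : nat) (X : topologicalType) (a : group_action X).

Definition diag_fun (g : G) (w : {ptws 'I_k -> X}) : {ptws 'I_k -> X} :=
  fun i => a g (w i).

Lemma diag_fun1 w : diag_fun 1%g w = w.
Proof. by apply/funext => i; exact: act1. Qed.

Lemma diag_funM g h w : diag_fun (g * h)%g w = diag_fun g (diag_fun h w).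
Proof. by apply/funext => i; exact: actM. Qed.

(* {ptws 'I_k -> X} is X^k with the product topology. *)
Definition diag_action : group_action {ptws 'I_k -> X} :=
  GroupAction diag_fun1 diag_funM.
End Diagonal.

Definition topologically_k_transitive (k : nat) (X : topologicalType)
    (a : group_action X) := topologically_transitive (diag_action k a).

End Actions.

Definition transitivity_degree (R : realType) (G : groupType) : \bar R :=
  ereal_sup [set (k%:R%:E : \bar R) | k in
    [set k : nat | exists (Omega : Type) (a : group_action G Omega),
       faithful_action a /\ k_transitive k a]].

Section MetricNotions.
Variables (R : realType) (S : metricType R).

Definition gromov_product (o x y : S) : R :=
  (mdist x o + mdist y o - mdist x y) / 2.

Definition geodesic_space := forall x y : S, exists gamma : R -> S,
  [/\ gamma 0 = x, gamma (mdist x y) = y &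
    forall s t, 0 <= s <= mdist x y -> 0 <= t <= mdist x y ->
      mdist (gamma s) (gamma t) = `|s - t|].

Definition gromov_hyperbolic := exists2 delta : R, 0 <= delta &
  forall x y z o : S,
    Num.min (gromov_product o x z) (gromov_product o z y) - delta
      <= gromov_product o x y.

Definition unbounded_set (A : set S) :=
  ~ exists M : R, forall x y, A x -> A y -> mdist x y <= M.

(* The choice of the base point is immaterial, see [gromov_product_base]. *)
Definition gromov_equiv (x y : nat -> S) := forall o,
  gromov_product o (x ij.1) (y ij.2)
    @[ij --> filter_prod \oo \oo] --> +oo.

Definition goes_to_infinity (x : nat -> S) := gromov_equiv x x.

End MetricNotions.

Record hyperbolicSpace (R : realType) := HyperbolicSpace {
  hyperbolic_carrier :> metricType R;
  hyperbolic_geodesic : geodesic_space hyperbolic_carrier;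
  hyperbolic_gromov : gromov_hyperbolic hyperbolic_carrier
}.

(* A boundary point is an equivalence class of sequences; [seqs_to a] is the
   class itself, i.e. the set of sequences converging to a. *)
Record boundary (R : realType) (S : hyperbolicSpace R) := Boundary {
  seqs_to : set (nat -> S);
  seqs_toP : exists2 x, goes_to_infinity x &
    seqs_to = [set y | goes_to_infinity y /\ gromov_equiv x y]
}.

HB.instance Definition _ R S := gen_eqMixin (@boundary R S).
HB.instance Definition _ R S := gen_choiceMixin (@boundary R S).

Section Boundary.
Variables (R : realType) (S : hyperbolicSpace R).
Implicit Types (o : S) (a b c : boundary S) (x y z : nat -> S).

Definition boundary_product o a b : \bar R :=
  ereal_inf [set limf_einf
      (fun ij : nat * nat => (gromov_product o (x ij.1) (y ij.2))%:E)
      (filter_prod \oo \oo) | x in seqs_to a & y in seqs_to b].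

Definition boundary_ball o a (r : R) : set (boundary S) :=
  [set b | r%:E < boundary_product o a b]%E.

(* Again independent of o, see [boundary_nbhsE]. *)
Definition boundary_nbhs a : set_system (boundary S) :=
  [set U | forall o, exists2 r, 0 <= r & boundary_ball o a r `<=` U].

Lemma boundary_eq a b : seqs_to a = seqs_to b -> a = b.
Proof. by case: a b => a pa [b pb] /= ab; subst b; congr Boundary; exact: Prop_irrelevance. Qed.

Lemma near_prodP (P : nat * nat -> Prop) :
  (\forall p \near filter_prod \oo \oo, P p) <->
  exists N, forall i j, (N <= i)%N -> (N <= j)%N -> P (i, j).
Proof.
split=> [[[A B] /= [[M _ MA] [N _ NB]] AB]|[N H]].
  exists (maxn M N) => i j; rewrite !geq_max => /andP[Mi _] /andP[_ Nj].
  by apply: AB; split; [exact: MA|exact: NB].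
exists ([set i | (N <= i)%N], [set j | (N <= j)%N]) => /=.
  by split; exists N.
by move=> [i j] /= [Ni Nj]; exact: H.
Qed.

Lemma gromov_equivP x y : gromov_equiv x y <-> forall o (r : R), exists N,
  forall i j, (N <= i)%N -> (N <= j)%N -> r < gromov_product o (x i) (y j).
Proof.
split=> [xy o r|xy o].
  apply/(near_prodP (fun p => r < gromov_product o (x p.1) (y p.2))).
  by have /cvgryPgt := xy o; apply.
apply/cvgryPgt => r.
by apply/(near_prodP (fun p => r < gromov_product o (x p.1) (y p.2))).
Qed.

Lemma gromov_productC o (p q : S) : gromov_product o p q = gromov_product o q p.
Proof. by rewrite /gromov_product (metric_sym p q) (addrC (mdist p o)). Qed.

Lemma gromov_product_base o o' (p q : S) :
  gromov_product o' p q - mdist o o' <= gromov_product o p q.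
Proof.
rewrite /gromov_product.
have := metric_triangle p o o'; have := metric_triangle q o o'; lra.
Qed.

Lemma gromov_equiv_sym x y : gromov_equiv x y -> gromov_equiv y x.
Proof.
move=> /gromov_equivP xy; apply/gromov_equivP => o r.
have [N HN] := xy o r; exists N => i j Ni Nj.
by rewrite gromov_productC; exact: HN.
Qed.

Lemma gromov_equiv_trans x y z :
  gromov_equiv x y -> gromov_equiv y z -> gromov_equiv x z.
Proof.
have [d d0 hd] := hyperbolic_gromov S.
move=> /gromov_equivP xy /gromov_equivP yz; apply/gromov_equivP => o r.
have [M HM] := xy o (r + d); have [N HN] := yz o (r + d).
exists (maxn M N) => i j; rewrite !geq_max => /andP[Mi _] /andP[_ Nj].
apply: lt_le_trans (hd _ _ (y (maxn M N)) _).
by rewrite ltrBrDr lt_min HM ?HN ?leq_maxl ?leq_maxr.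
Qed.

Lemma seqs_to_equiv a x y : seqs_to a x -> seqs_to a y -> gromov_equiv x y.
Proof.
have [z _ ->] := seqs_toP a => -[_ zx] [_ zy].
exact: gromov_equiv_trans (gromov_equiv_sym zx) zy.
Qed.

Lemma seqs_to_nonempty a : exists x, seqs_to a x.
Proof. by have [x xoo ->] := seqs_toP a; exists x. Qed.

Lemma boundary_product_gt o a b (r : R) : (r%:E < boundary_product o a b)%E ->
  forall x y, seqs_to a x -> seqs_to b y -> exists N, forall i j, (N <= i)%N -> (N <= j)%N ->
    r < gromov_product o (x i) (y j).
Proof.
move=> rab x y ax byy.
have : (r%:E < limf_einf
    (fun ij : nat * nat => (gromov_product o (x ij.1) (y ij.2))%:E)
    (filter_prod \oo \oo))%E.
  by apply: (lt_le_trans rab); apply: ereal_inf_lbound; exists x => //; exists y.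
rewrite limf_einfE => /ereal_sup_gt[_ [V FV <-] rV].
have [N HN] : exists N, forall i j, (N <= i)%N -> (N <= j)%N -> V (i, j).
  by apply/near_prodP.
exists N => i j Ni Nj; rewrite -lte_fin; apply: (lt_le_trans rV).
by apply: ereal_inf_lbound; exists (i, j) => //; exact: HN.
Qed.

Lemma boundary_product_ge o a b (r : R) :
  (forall x y, seqs_to a x -> seqs_to b y -> exists N, forall i j, (N <= i)%N -> (N <= j)%N ->
     r <= gromov_product o (x i) (y j)) ->
  (r%:E <= boundary_product o a b)%E.
Proof.
move=> rab; apply: le_ereal_inf_tmp => _ [x ax [y byy <-]].
rewrite limf_einfE.
have [N HN] := rab x y ax byy.
set V : set (nat * nat) := [set p | (N <= p.1)%N /\ (N <= p.2)%N].
have FV : filter_prod \oo \oo V.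
  by apply/(near_prodP V); exists N.
apply: le_trans; last by apply: ereal_sup_ubound; exists V.
apply: le_ereal_inf_tmp => _ [[i j] [/= Ni Nj] <-].
by rewrite lee_fin; exact: HN.
Qed.

Lemma boundary_ball_center o a r : boundary_ball o a r a.
Proof.
apply: (@lt_le_trans _ _ (r + 1)%:E); first by rewrite lte_fin; lra.
apply: boundary_product_ge => x y ax ay.
have [N HN] := (gromov_equivP x y).1 (seqs_to_equiv ax ay) o (r + 1).
by exists N => i j Ni Nj; apply/ltW/HN.
Qed.

Lemma boundary_ball_base o o' a r :
  boundary_ball o' a (r + mdist o o' + 1) `<=` boundary_ball o a r.
Proof.
move=> b ab; apply: (@lt_le_trans _ _ (r + 1)%:E); first by rewrite lte_fin; lra.
apply: boundary_product_ge => x y ax byy.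
have [N HN] := boundary_product_gt ab ax byy.
exists N => i j Ni Nj; have := gromov_product_base o o' (x i) (y j).
have := HN i j Ni Nj; lra.
Qed.

Lemma boundary_nbhsE o a (U : set (boundary S)) :
  boundary_nbhs a U <-> exists2 r, 0 <= r & boundary_ball o a r `<=` U.
Proof.
split=> [/(_ o)//|[r r0 rU] o'].
exists (r + mdist o o' + 1); first by have := mdist_ge0 o o'; lra.
exact: subset_trans (@boundary_ball_base _ _ _ _) rU.
Qed.

Lemma boundary_ballS o a (r s : R) : r <= s ->
  boundary_ball o a s `<=` boundary_ball o a r.
Proof. by move=> rs b; apply: le_lt_trans; rewrite lee_fin. Qed.

Lemma boundary_base_point a : exists o : S, True.
Proof. by have [x _] := seqs_to_nonempty a; exists (x 0%N). Qed.

Lemma boundary_nbhs_filter a : ProperFilter (boundary_nbhs a).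
Proof.
split.
  have [p _] := boundary_base_point a.
  by move=> /(_ p)[r _ /(_ a)]; apply; exact: boundary_ball_center.
split=> [p|U V aU aV o|U V UV aU o].
- by exists 0.
- have [r r0 rU] := aU o; have [s s0 sV] := aV o.
  exists (Num.max r s); first by rewrite le_max r0.
  move=> b ab; split; [apply: rU|apply: sV]; apply: boundary_ballS ab.
    by rewrite le_max lexx.
  by rewrite le_max lexx orbT.
- have [r r0 rU] := aU o; exists r => //; exact: subset_trans rU UV.
Qed.

Lemma boundary_nbhs_singleton a (U : set (boundary S)) :
  boundary_nbhs a U -> U a.
Proof.
have [p _] := boundary_base_point a.
by move=> /(_ p)[r _]; apply; exact: boundary_ball_center.
Qed.

Lemma boundary_nbhs_nbhs a (U : set (boundary S)) :
  boundary_nbhs a U -> boundary_nbhs a (boundary_nbhs^~ U).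
Proof.
have [d d0 hd] := hyperbolic_gromov S.
move=> aU o; have [r r0 rU] := aU o.
exists (r + d + 1); first by lra.
move=> b ab; apply/(boundary_nbhsE o); exists (r + d + 1); first by lra.
move=> c bc; apply: rU.
apply: (@lt_le_trans _ _ (r + 1)%:E); first by rewrite lte_fin; lra.
apply: boundary_product_ge => x z ax cz.
have [y byy] := seqs_to_nonempty b.
have [M HM] := boundary_product_gt ab ax byy.
have [N HN] := boundary_product_gt bc byy cz.
exists (maxn M N) => i j; rewrite !geq_max => /andP[Mi _] /andP[_ Nj].
apply: le_trans (hd _ _ (y (maxn M N)) _).
rewrite lerBrDr le_min; apply/andP; split; apply/ltW.
  by rewrite addrAC; apply: HM => //; exact: leq_maxl.
by rewrite addrAC; apply: HN => //; exact: leq_maxr.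
Qed.

HB.instance Definition _ := hasNbhs.Build (boundary S) boundary_nbhs.
HB.instance Definition _ := Nbhs_isNbhsTopological.Build (boundary S)
  boundary_nbhs_filter boundary_nbhs_singleton boundary_nbhs_nbhs.

End Boundary.

Record isometric_action (R : realType) (G : groupType) (S : metricType R) :=
  IsometricAction {
    isometric_act :> group_action G S;
    isometric_actP : forall g (x y : S),
      mdist (isometric_act g x) (isometric_act g y) = mdist x y
  }.

Section Isometric.
Variables (R : realType) (G : groupType) (S : hyperbolicSpace R).
Variable A : isometric_action G S.

Lemma gromov_product_act g (o x y : S) :
  gromov_product (A g o) (A g x) (A g y) = gromov_product o x y.
Proof. by rewrite /gromov_product !isometric_actP. Qed.

Lemma gromov_equiv_act g (x y : nat -> S) :
  gromov_equiv x y -> gromov_equiv (A g \o x) (A g \o y).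
Proof.
move=> /gromov_equivP xy; apply/gromov_equivP => o r.
have [N HN] := xy (A g^-1%g o) r; exists N => i j Ni Nj /=.
rewrite -(actK A g^-1%g o) invgK gromov_product_act; exact: HN.
Qed.

Lemma act_seqK g (x : nat -> S) : A g \o (A g^-1%g \o x) = x.
Proof. by apply/funext => n /=; rewrite -{1}(invgK g) actK. Qed.

Lemma boundary_actP g (a : boundary S) :
  exists2 x, goes_to_infinity x & [set A g \o x | x in seqs_to a] =
    [set y | goes_to_infinity y /\ gromov_equiv x y].
Proof.
have [x xoo ->] := seqs_toP a.
exists (A g \o x); first exact: gromov_equiv_act.
apply/seteqP; split=> [_ [y [yoo xy] <-]|y [yoo xy]].
  by split; exact: gromov_equiv_act.
exists (A g^-1%g \o y); last exact: act_seqK.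
split; first exact: gromov_equiv_act.
rewrite -(act_seqK g^-1%g x) invgK; exact: gromov_equiv_act.
Qed.

Definition boundary_act g (a : boundary S) : boundary S :=
  Boundary (boundary_actP g a).

Lemma boundary_act1 a : boundary_act 1%g a = a.
Proof.
apply: boundary_eq => /=; rewrite -[RHS]image_id; apply: eq_imagel => x _.
by apply/funext => n /=; rewrite act1.
Qed.

Lemma boundary_actM g h a :
  boundary_act (g * h)%g a = boundary_act g (boundary_act h a).
Proof.
apply: boundary_eq; rewrite /= image_comp; apply: eq_imagel => x _.
by apply/funext => n /=; rewrite actM.
Qed.

Definition boundary_action : group_action G (boundary S) :=
  GroupAction boundary_act1 boundary_actM.

Lemma boundary_action_ball g o a r (b : boundary S) :
  boundary_ball (A g o) (boundary_action g a) r (boundary_action g b) <->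
  boundary_ball o a r b.
Proof.
rewrite /boundary_ball /= (_ : boundary_product _ _ _ = boundary_product o a b)//.
congr ereal_inf; apply/seteqP; split=> [_ [_ [x ax <-] [_ [y byy <-] <-]]|].
  exists x => //; exists y => //; congr limf_einf.
  by apply/funext => ij /=; rewrite gromov_product_act.
move=> _ [x ax [y byy <-]].
exists (A g \o x); first by exists x.
exists (A g \o y); first by exists y.
by congr limf_einf; apply/funext => ij /=; rewrite gromov_product_act.
Qed.

Lemma boundary_action_continuous g : continuous (boundary_action g).
Proof.
move=> a U gaU; apply: (_ : boundary_nbhs a _) => o.
have [r r0 rU] := gaU (A g o); exists r => // b ab.
by apply: rU; apply/boundary_action_ball.
Qed.

Definition limit_set : set (boundary S) :=
  [set a | exists (s : S) (u : nat -> G), seqs_to a (fun n => A (u n) s)].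

Lemma limit_set_act g (a : limit_set) :
  boundary_action g (set_val a) \in limit_set.
Proof.
rewrite inE; have [s [u asu]] : limit_set (set_val a) by exact: set_valP.
exists s, (fun n => g * u n)%g; exists (fun n => A (u n) s) => //.
by apply/funext => n /=; rewrite actM.
Qed.

Definition limit_act g (a : limit_set) : limit_set :=
  exist _ (boundary_action g (set_val a)) (limit_set_act g a).

Lemma limit_act1 a : limit_act 1%g a = a.
Proof. by apply: val_inj; exact: act1. Qed.

Lemma limit_actM g h a : limit_act (g * h)%g a = limit_act g (limit_act h a).
Proof. by apply: val_inj; exact: actM. Qed.

(* The type [limit_set] carries the subspace topology of [boundary S]. *)
Definition limit_action : group_action G limit_set :=
  GroupAction limit_act1 limit_actM.

Definition cyclic_subgroup (g : G) : set G :=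
  [set h | exists n : nat, h = (g ^+ n)%g \/ h = (g ^- n)%g].

Definition loxodromic (g : G) :=
  (forall s : S, unbounded_set [set A h s | h in cyclic_subgroup g]) /\
  exists a b, a <> b /\ fixed_points boundary_action g = [set a; b].

Definition general_type :=
  (forall s : S, unbounded_set [set A g s | g in [set: G]]) /\
  exists g h, [/\ loxodromic g, loxodromic h &
    fixed_points boundary_action g `&` fixed_points boundary_action h = set0].

End Isometric.

Definition faithful_weakly_hyperbolic (R : realType) (G : groupType) :=
  exists (S : hyperbolicSpace R) (A : isometric_action G S),
    general_type A /\ faithful_action (limit_action A).

Definition lim_free (R : realType) (G : groupType) :=
  exists (S : hyperbolicSpace R) (A : isometric_action G S),
    general_type A /\ topologically_free (limit_action A).

(* Main.v *)
Require Import Defs.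
From mathcomp Require Import all_boot all_order all_algebra.
From mathcomp Require Import all_classical all_reals all_analysis.
From mathcomp Require Import lra.

Set Implicit Arguments.
Unset Strict Implicit.
Unset Printing Implicit Defensive.
Import Order.TTheory GRing.Theory Num.Theory.
Import numFieldNormedType.Exports.
Local Open Scope classical_set_scope.
Local Open Scope ring_scope.

(* Write X for the limit set.  Some element of G maps the complement of any given
   nonempty open subset of X into any other one; as G is not lim-free, some
   nontrivial element fixes an open subset of X pointwise, so every nonempty open
   set supports nontrivial elements.  Moreover, by a cross-ratio estimate, suitable
   small disjoint sets P and Q do not cross: no g makes both gP and gQ meet both P
   and Q.

   Let now G act faithfully and 3-transitively on a set T.  If f and h are
   supported on non-crossing disjoint subsets of X, then for every g one of the
   four commutators of gfg^-1, ghg^-1 with f, h is trivial.  As a suitable choice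
   of the images under g of three points of T makes all four of them nontrivial as
   soon as f and h, each having a fixed point in T, move a common point of T, the
   supports of f and h in T are disjoint.  Three elements with supports in the
   open sets U_i of X hence move three distinct points w_i of T, and likewise three
   elements for open sets V_i move v_i; an element g taking each w_i to v_i makes
   g U_i meet V_i. *)

(** * Actions and supports *)

Section ActionFacts.
Variables (G : groupType) (X : Type) (a : group_action G X).

Lemma actVK g : cancel (a g^-1%g) (a g).
Proof. by move=> x; rewrite -actM mulgV act1. Qed.

Lemma act_inj g x y : a g x = a g y -> x = y.
Proof. exact: (can_inj (actK a g)). Qed.

Lemma act_conj g f x : a (g * f * g^-1)%g (a g x) = a g (a f x).
Proof. by rewrite !actM actK. Qed.

Definition supported (U : set X) (f : G) := forall x, ~ U x -> a f x = x.

Lemma supported_sub (U V : set X) f :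
  U `<=` V -> supported U f -> supported V f.
Proof. by move=> UV Uf x nVx; apply: Uf => /UV. Qed.

Lemma supported_moved U f x : supported U f -> a f x <> x -> U x.
Proof. by move=> Uf fx; apply: contrapT => /Uf. Qed.

Lemma supported_conj U f g :
  supported U f -> supported (a g @` U) (g * f * g^-1)%g.
Proof.
move=> Uf x nUx; rewrite -[x](actVK g) act_conj Uf// => Ux.
by apply: nUx; exists (a g^-1%g x) => //; exact: actVK.
Qed.

Lemma faithful_eq (f h : G) :
  faithful_action a -> (forall x, a f x = a h x) -> f = h.
Proof.
move=> fa fh; suff: (h^-1 * f)%g = 1%g.
  by move=> /(congr1 (fun k => h * k)%g); rewrite mulgA mulgV mul1g mulg1.
by apply: fa => x; rewrite actM fh actK.
Qed.

Lemma faithful_moved f : faithful_action a -> f <> 1%g -> exists x, a f x <> x.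
Proof.
move=> fa f1; apply: contrapT => H; apply/f1/fa => x.
by apply: contrapT => fx; apply: H; exists x.
Qed.

Lemma supported_commute U V f h : faithful_action a ->
  supported U f -> supported V h -> U `&` V = set0 -> (f * h = h * f)%g.
Proof.
move=> fa Uf Vh UV; apply: faithful_eq => // x; rewrite !actM.
have dUV y : U y -> V y -> False by move=> Uy Vy; have : set0 y by rewrite -UV.
have [hx|hx] := pselect (a h x = x).
  rewrite hx; have [->//|fx] := pselect (a f x = x).
  rewrite Vh// => Vfx; apply: (dUV (a f x)) => //.
  by apply: (supported_moved Uf) => /act_inj.
have Vx : V x by exact: (supported_moved Vh hx).
have Vhx : V (a h x) by apply: (supported_moved Vh) => /act_inj.
by rewrite (Uf x) ?(Uf (a h x))//; [move=> /dUV/(_ Vhx)|move=> /dUV/(_ Vx)].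
Qed.

Definition noncrossing (P Q : set X) := forall g,
  ~ [/\ (a g @` P) `&` P !=set0, (a g @` P) `&` Q !=set0,
        (a g @` Q) `&` P !=set0 & (a g @` Q) `&` Q !=set0].

End ActionFacts.

Lemma three_transitive (G : groupType) (T : Type) (b : group_action G T)
    (x y z x' y' z' : T) : k_transitive 3 b ->
  x <> y -> x <> z -> y <> z -> x' <> y' -> x' <> z' -> y' <> z' ->
  exists g, [/\ b g x = x', b g y = y' & b g z = z'].
Proof.
move=> tb xy xz yz xy' xz' yz'.
pose s (u v w : T) (i : 'I_3) : T :=
  if val i == 0%N then u else if val i == 1%N then v else w.
have sI u v w : u <> v -> u <> w -> v <> w -> injective (s u v w).
  move=> uv uw vw [[|[|[|//]]] i] [[|[|[|//]]] j]; rewrite /s /= => e;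
    by apply: val_inj => //=; congruence.
have [g gP] := tb _ _ (sI x y z xy xz yz) (sI _ _ _ xy' xz' yz').
exists g; split.
- by have := gP (@Ordinal 3 0 isT).
- by have := gP (@Ordinal 3 1 isT).
- by have := gP (@Ordinal 3 2 isT).
Qed.

(** * Disjoint supports in a faithful 3-transitive action *)

Section Rigidity.
Variables (G : groupType) (X : Type) (a : group_action G X).
Hypothesis fa : faithful_action a.
Variables (T : Type) (b : group_action G T).
Hypothesis tb : k_transitive 3 b.

Lemma supports_disjoint (P Q : set X) (f h : G) (v w : T) :
  P `&` Q = set0 -> noncrossing a P Q ->
  supported a P f -> supported a Q h -> b f v = v -> b h w = w ->
  forall p, b f p <> p -> b h p <> p -> False.
Proof.
move=> PQ nPQ Pf Qh fv hw p fp hp.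
have bI g x y : b g x = b g y -> x = y by exact: act_inj.
have fh : (f * h = h * f)%g by exact: (supported_commute fa Pf Qh PQ).
have fhE x : b f (b h x) = b h (b f x) by rewrite -!actM fh.
(* If [g U] missed [V], the conjugate of [k] and [l] would have disjoint supports in [X], hence
   commute in [G]; failing to commute at one point of [T] excludes this. *)
have meets U V k l g : supported a U k -> supported a V l ->
    (exists x, b l (b (g * k * g^-1)%g x) <> b (g * k * g^-1)%g (b l x)) ->
    (a g @` U) `&` V !=set0.
  move=> Uk Vl [x lx]; apply: contrapT => /set0P/negP/negPn/eqP UV; apply: lx.
  by rewrite -!actM (supported_commute fa (supported_conj (g := g) Uk) Vl UV).
have absurd g :
  (forall k l, (k = f \/ k = h) -> (l = f \/ l = h) ->
    exists x, b l (b (g * k * g^-1)%g x) <> b (g * k * g^-1)%g (b l x)) -> False.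
  move=> H; apply: (nPQ g); split.
  - by apply: (meets _ _ _ _ _ Pf Pf); apply: H; left.
  - by apply: (meets _ _ _ _ _ Pf Qh); apply: H; [left|right].
  - by apply: (meets _ _ _ _ _ Qh Pf); apply: H; [right|left].
  - by apply: (meets _ _ _ _ _ Qh Qh); apply: H; right.
have hfp : b h (b f p) <> b f p by rewrite -fhE => /bI.
have fhp : b f (b h p) <> b h p by rewrite fhE => /bI.
have ffp : b f (b f p) <> b f p by move=> /bI.
(* The conditions on g make g f g^-1 and g h g^-1 move z, which f and h fix, to
   points that f and h move. *)
have [[z [fz hz]]|nofix] := pselect (exists z, b f z = z /\ b h z = z).
  have [g [gp gf gh]] : exists g,
      [/\ b g p = z, b g (b f p) = p \/ b g (b f p) = b f p
       & b g (b h p) = p \/ b g (b h p) = b f p].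
    (* When [f p = h p] only two images are prescribed; sending [z] to [f p] merely completes the
       triples. *)
    have [e|ne] := pselect (b f p = b h p).
      have [||||||g [gp gf _]] := @three_transitive _ _ b p (b f p) z z p (b f p) tb;
        try congruence.
      by exists g; split=> //; left; rewrite -?e.
    have [||||||g [gp gf gh]] := @three_transitive _ _ b p (b f p) (b h p) z p (b f p) tb;
        try congruence.
    by exists g; split=> //; [left|right].
  apply: (absurd g) => k l kE lE; exists z.
  have -> : b l z = z by case: lE => ->.
  have -> : b (g * k * g^-1)%g z = b g (b k p) by rewrite -gp act_conj.
  by case: kE => ->; case: lE => ->; [case: gf|case: gf|case: gh|case: gh] => ->.
(* Now g f g^-1 fixes p but not f p and h p, while g h g^-1 moves p but fixes
   f p and h p. *)
have fw : b f w <> w by move=> fw; apply: nofix; exists w.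
have hv : b h v <> v by move=> hv; apply: nofix; exists v.
have hfw : b h (b f w) = b f w by rewrite -fhE hw.
have ffw : b f (b f w) <> b f w by move=> /bI.
have [g [gv gf gh]] : exists g,
    [/\ b g v = p, b g w = b f p \/ b g (b f w) = b f p
     & b g w = b h p \/ b g (b f w) = b h p].
  have [e|ne] := pselect (b f p = b h p).
    have [||||||g [gp gf _]] := @three_transitive _ _ b v w (b f w) p (b f p) v tb;
      try congruence.
    by exists g; split=> //; left; rewrite -?e.
  have [||||||g [gp gf gh]] := @three_transitive _ _ b v w (b f w) p (b f p) (b h p) tb;
      try congruence.
  by exists g; split=> //; [left|right].
have Ff : b (g * f * g^-1)%g p = p by rewrite -gv act_conj fv.
have Ffl l : l = f \/ l = h -> b (g * f * g^-1)%g (b l p) <> b l p.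
  by case=> ->; [case: gf|case: gh] => <-; rewrite act_conj => /bI.
have Fh : b (g * h * g^-1)%g p <> p by rewrite -gv act_conj => /bI.
have Fhl l : l = f \/ l = h -> b (g * h * g^-1)%g (b l p) = b l p.
  by case=> ->; [case: gf|case: gh] => <-; rewrite act_conj ?hw ?hfw.
apply: (absurd g) => k l [] -> lE; exists p.
  by rewrite Ff => /esym; exact: Ffl.
by rewrite Fhl// => /bI.
Qed.

End Rigidity.

(** * Topological actions *)

Lemma disjointP (T : Type) (A B : set T) :
  A `&` B = set0 <-> forall x, A x -> B x -> False.
Proof.
split=> [AB x Ax Bx|AB]; first by have : set0 x by rewrite -AB.
by apply/seteqP; split=> // x [Ax /(AB x Ax)].
Qed.

Lemma hausdorff_separate (X : topologicalType) (x y : X) :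
  hausdorff_space X -> x <> y -> exists U V : set X,
    [/\ open U, open V, U x, V y & U `&` V = set0].
Proof.
rewrite open_hausdorff => hX /eqP/hX[[U V] /= [xU yV] [oU oV /eqP UV]].
by exists U, V; rewrite !inE in xU yV.
Qed.

Section TopologicalActions.
Variables (G : groupType) (X : topologicalType) (a : group_action G X).
Hypothesis hX : hausdorff_space X.
Hypothesis ca : forall g, continuous (a g).
Let aI g x y : a g x = a g y -> x = y := @act_inj G X a g x y.

Lemma open_image g (U : set X) : open U -> open (a g @` U).
Proof.
move=> oU; rewrite (_ : a g @` U = a g^-1%g @^-1` U); last first.
  apply/seteqP; split=> [_ [x Ux <-]|x Ux] /=; first by rewrite actK.
  by exists (a g^-1%g x) => //; exact: actVK.
by apply: open_comp oU => x _; exact: ca.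
Qed.

Lemma displaced_nbhd f x (W : set X) : open W -> W x -> a f x <> x ->
  exists N, [/\ open N, N x, N `<=` W & (a f @` N) `&` N = set0].
Proof.
move=> oW Wx /(hausdorff_separate hX)[U [V [oU oV Ux Vx UV]]].
exists ((W `&` V) `&` (a f @^-1` U)); split.
- apply: openI; first exact: openI.
  by apply: open_comp oU => y _; exact: ca.
- by [].
- by move=> y [[]].
apply/disjointP => _ [y [_ Uy] <-] [[_ Vy] _].
by move/disjointP: UV; apply; eassumption.
Qed.

Lemma open_moved f : open [set x | a f x <> x].
Proof.
rewrite openE => x fx.
have [N [oN Nx _ fN]] := displaced_nbhd openT I fx.
apply: filterS (open_nbhs_nbhs (conj oN Nx)) => y Ny fy.
by move/disjointP: fN => /(_ y); apply=> //; exists y.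
Qed.

(* Otherwise elements fixing open sets act freely on T, so that two elements that
   agree on an open subset of X and at one point of T are equal.  With f, k, d as in
   the proof and g chosen so that g f g^-1 agrees with f, and g d g^-1 with k d, at
   a point of T, both pairs are then equal; but f and d commute, f and k d do not. *)
Lemma exists_fixing (T : Type) (b : group_action G T) (W M O : set X) :
  faithful_action a -> faithful_action b -> k_transitive 3 b ->
  (forall U, open U -> U !=set0 -> exists2 f, f <> 1%g & supported a U f) ->
  open W -> open M -> open O -> W !=set0 -> M !=set0 -> O !=set0 ->
  W `&` M = set0 -> W `&` O = set0 -> M `&` O = set0 ->
  exists f (U : set X), [/\ f <> 1%g, open U, U !=set0,
    forall x, U x -> a f x = x & exists p, b f p = p].
Proof.
move=> fa fb tb ra oW oM oO W0 M0 O0 WM WO MO.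
apply: contrapT => H.
have free k l U y : open U -> U !=set0 -> (forall x, U x -> a k x = a l x) ->
    b k y = b l y -> k = l.
  move=> oU U0 kl kly; apply: contrapT => nkl; apply: H.
  exists (l^-1 * k)%g, U; split=> //.
  - move=> /(congr1 (fun k => l * k)%g); rewrite mulgA mulgV mul1g mulg1 //.
  - by move=> x Ux; rewrite actM kl// actK.
  - by exists y; rewrite actM kly actK.
have free1 k U y : open U -> U !=set0 -> (forall x, U x -> a k x = x) ->
    k <> 1%g -> b k y <> y.
  move=> oU U0 kU k1 ky; apply/k1/(free _ _ U y) => // [x Ux|]; last by rewrite act1.
  by rewrite act1 kU.
have [f f1 Wf] := ra _ oW W0.
have [d d1 Md] := ra _ oM M0.
have [x fx] := faithful_moved fa f1.
have Wx := supported_moved Wf fx.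
have [N [oN Nx NW fN]] := displaced_nbhd oW Wx fx.
have [k k1 Nk] := ra _ oN (ex_intro _ x Nx).
have Wk := supported_sub NW Nk.
have fd : (f * d = d * f)%g := supported_commute fa Wf Md WM.
have kd : (k * d = d * k)%g := supported_commute fa Wk Md WM.
(* [k] moves some [z] in [N], and fixes [f z], which lies outside [N]; so [f k z = k f z] would give
   [k z = z]. *)
have fk : (f * k <> k * f)%g.
  move=> /(congr1 a)fk; have [z kz] := faithful_moved fa k1.
  have := congr1 (fun u => u z) fk; rewrite !actM (Nk (a f z)).
    by move/aI.
  move/disjointP: fN => fN Nfz; apply: (fN (a f z)) => //.
  by exists z => //; exact: (supported_moved Nk kz).
have fkd : (f * (k * d) <> k * d * f)%g.
  rewrite mulgA -(mulgA k) -fd mulgA => /(congr1 (fun u => u * d^-1)%g).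
  by rewrite -!mulgA !mulgV !mulg1.
have [p fp] := faithful_moved fb f1.
have trivO l : supported a (W `|` M) l -> forall y, O y -> a l y = y.
  move=> Ul y Oy; apply: Ul => -[Wy|My].
    by move/disjointP: WO; apply; eassumption.
  by move/disjointP: MO; apply; eassumption.
have fO := trivO f (supported_sub (@subsetUl _ _ _) Wf).
have dO := trivO d (supported_sub (@subsetUr _ _ _) Md).
have kO := trivO k (supported_sub (@subsetUl _ _ _) Wk).
have kdO y : O y -> a (k * d)%g y = y by move=> Oy; rewrite actM dO// kO.
have dp : b d p <> p by exact: (free1 _ O).
have kdp : b (k * d)%g p <> p.
  apply: (free1 _ O) => // e; apply: fkd; by rewrite e mul1g mulg1.
have fdp : b f p <> b d p.
  move=> /(free _ _ O) e; apply: fk; rewrite e ?kd// => y Oy.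
  by rewrite fO ?dO.
have fkdp : b f p <> b (k * d)%g p.
  move=> /(free _ _ O) e; apply: fkd; rewrite -e// => y Oy.
  by rewrite fO ?kdO.
have [||||||g [gp gf gd]] := @three_transitive _ _ b p (b f p) (b d p)
  p (b f p) (b (k * d)%g p) tb; try by [|apply/nesym].
pose F := (g * f * g^-1)%g; pose D := (g * d * g^-1)%g.
have Fp : b F p = b f p by rewrite -{1}gp act_conj gf.
have Dp : b D p = b (k * d)%g p by rewrite -{1}gp act_conj gd.
have FD : (F * D = D * F)%g.
  rewrite /F /D -!mulgA; congr (_ * _)%g.
  by rewrite !(mulgA g^-1%g g) !mulVg !mul1g !mulgA fd.
(* The supports of [F] and [D] lie in [g W] and [g M], which are disjoint. *)
have disj y : a F y <> y -> a D y <> y -> False.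
  rewrite -(actVK a g y) !act_conj.
  set z := a g^-1%g y => Fz Dz; move/disjointP: WM => /(_ z); apply.
    by apply: (supported_moved Wf) => fz; rewrite fz in Fz.
  by apply: (supported_moved Md) => dz; rewrite dz in Dz.
have disjF y : a F y <> y -> a D y = y.
  by move=> Fy; apply: contrapT => /(disj y Fy).
have disjD y : a D y <> y -> a F y = y.
  by move=> Dy; apply: contrapT => /disj; apply.
(* By [free], agreement at [p] and on a nonempty open set suffices. For [i1] this set consists of
   the points moved by [d], fixed by both [F] and [f]; for [i2] it is [f N], fixed by [D] and [k d];
   for [i3] it is the part of [O] moved by [F], nonempty because [F] and [f] cannot agree on [O]. *)
have i1 : D = (k * d)%g -> F = f.
  move=> DE; apply: (free _ _ [set y | a d y <> y] p) => //.
  - exact: open_moved.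
  - exact: faithful_moved.
  move=> y /= dy; have My := supported_moved Md dy.
  have nW z : M z -> ~ W z by move=> Mz Wz; move/disjointP: WM; apply; eassumption.
  rewrite (Wf y (nW y My)); apply: disjD; rewrite DE actM Wk//.
  by apply/nW/(supported_moved Md) => /aI.
have i2 : F = f -> D = (k * d)%g.
  move=> FE; apply: (free _ _ (a f @` N) p) => //; first exact: open_image.
    by exists (a f x); exists x.
  move=> _ [z Nz <-].
  have fz : a f z <> z.
    by move=> fz; move/disjointP: fN => /(_ z); apply=> //; exists z.
  have Wz : W (a f z) by apply: (supported_moved Wf) => /aI.
  rewrite disjF ?FE; last by move/aI.
  rewrite actM (Md (a f z)); last first.
    by move=> Mz; move/disjointP: WM; apply; eassumption.
  have nN : ~ N (a f z).
    by move=> Nfz; move/disjointP: fN => /(_ (a f z)); apply=> //; exists z.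
  by rewrite Nk.
have i3 : F <> f -> D = (k * d)%g.
  move=> nF; have [y [Oy Fy]] : exists y, O y /\ a F y <> y.
    apply: contrapT => H'; apply/nF/(free _ _ O p) => // y Oy.
    by rewrite fO//; apply: contrapT => Fy; apply: H'; exists y.
  apply: (free _ _ (O `&` [set z | a F z <> z]) p) => //.
  - by apply: openI => //; exact: open_moved.
  - by exists y.
  by move=> z [Oz Fz]; rewrite disjF// kdO.
have FE : F = f by apply: contrapT => nF; apply/nF/i1/i3.
by apply: fkd; rewrite -(i2 FE) -FE FD.
Qed.

End TopologicalActions.

(** The sets containing a box around [w] form a filter. The topology is the supremum of those pulled
    back along the coordinates, so convergence to [w] is checked on cylinders over one coordinate,
    and these are boxes. *)
Lemma open_ptws_box (k : nat) (X : topologicalType) (U : set {ptws 'I_k -> X})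
    (w : {ptws 'I_k -> X}) : open U -> U w ->
  exists V : 'I_k -> set X, (forall i, open (V i) /\ V i (w i)) /\
    forall v : {ptws 'I_k -> X}, (forall i, V i (v i)) -> U v.
Proof.
move=> oU Uw.
pose F : set_system {ptws 'I_k -> X} := [set B | exists V : 'I_k -> set X,
  (forall i, open (V i) /\ V i (w i)) /\
    forall v : {ptws 'I_k -> X}, (forall i, V i (v i)) -> B v].
have FF : Filter F.
  split.
  - by exists (fun=> setT); split=> // i; split=> //; exact: openT.
  - move=> P Q [V [oV VP]] [W [oW WQ]]; exists (fun i => V i `&` W i); split.
      move=> i; have [? ?] := oV i; have [? ?] := oW i.
      by split; [exact: openI|].
    by move=> v vVW; split; [apply: VP|apply: WQ] => i; have [] := vVW i.
  - by move=> P Q PQ [V [oV VP]]; exists V; split=> // v /VP/PQ.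
suff : F --> w by apply; exact: open_nbhs_nbhs.
apply/cvg_sup => i A [B [[C oC <-] /= Cw CA]].
exists (fun j => if j == i then C else setT); split.
  move=> j; case: eqP => [->//|_]; split=> //; exact: openT.
by move=> v /(_ i); rewrite eqxx => Cv; apply: CA.
Qed.

(** * Topological 3-transitivity from contraction and non-crossing *)

Section TopologicalTransitivity.
Variables (G : groupType) (X : topologicalType) (a : group_action G X).
Hypothesis hX : hausdorff_space X.
Hypothesis ca : forall g, continuous (a g).
Hypothesis fa : faithful_action a.
Hypothesis ep : forall O U : set X, open O -> open U -> O !=set0 -> U !=set0 ->
  exists g, forall x, ~ O x -> U (a g x).
Hypothesis shrink : forall U : set X, open U -> U !=set0 -> exists V : set X,
  [/\ open V, V !=set0, V `<=` U &
    forall Q, Q `&` U = set0 -> noncrossing a V Q].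
Variables (x1 x2 x3 : X).
Hypotheses (x12 : x1 <> x2) (x13 : x1 <> x3) (x23 : x2 <> x3).
Variables (f0 : G) (O0 : set X).
Hypotheses (f01 : f0 <> 1%g) (oO0 : open O0) (O00 : O0 !=set0).
Hypothesis f0O0 : forall x, O0 x -> a f0 x = x.
Variables (T : Type) (b : group_action G T).
Hypotheses (fb : faithful_action b) (tb : k_transitive 3 b).

Lemma conjg1 (g f : G) : (g * f * g^-1 = 1 -> f = 1)%g.
Proof.
move=> /(congr1 (fun u => g^-1 * u * g)%g).
by rewrite mulg1 mulVg !mulgA mulVg mul1g -mulgA mulVg mulg1.
Qed.

Lemma conj_supported f (O U : set X) : open O -> open U ->
  O !=set0 -> U !=set0 -> (forall x, O x -> a f x = x) ->
  exists g, supported a U (g * f * g^-1)%g.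
Proof.
move=> oO oU O1 U1 fO; have [g gP] := ep oO oU O1 U1.
exists g => x nUx; rewrite -[x](actVK a g) act_conj fO//.
by apply: contrapT => /gP; rewrite actVK.
Qed.

Lemma exists_supported (U : set X) : open U -> U !=set0 ->
  exists2 f, f <> 1%g & supported a U f.
Proof.
move=> oU U0; have [g gP] := conj_supported oO0 oU O00 U0 f0O0.
by exists (g * f0 * g^-1)%g => // /conjg1.
Qed.

Lemma exists_supported_fixing (U : set X) : open U -> U !=set0 ->
  exists f, [/\ f <> 1%g, supported a U f & exists p, b f p = p].
Proof.
move=> oU U0.
have [A1 [B1 [oA1 oB1 A1x B1x AB1]]] := hausdorff_separate hX x12.
have [A2 [B2 [oA2 oB2 A2x B2x AB2]]] := hausdorff_separate hX x13.
have [A3 [B3 [oA3 oB3 A3x B3x AB3]]] := hausdorff_separate hX x23.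
have sub (P Q P' Q' : set X) : P `&` Q = set0 -> P' `<=` P -> Q' `<=` Q ->
    P' `&` Q' = set0.
  move=> /disjointP PQ PP QQ; apply/disjointP => x /PP Px /QQ; exact: PQ.
have [|||||||||f [V [f1 oV V0 fV [p fp]]]] := @exists_fixing _ _ a hX ca T b
   (A1 `&` A2) (B1 `&` A3) (B2 `&` B3) fa fb tb exists_supported;
  do ?[exact: openI|by exists x1|by exists x2|by exists x3].
- by apply: sub AB1 _ _ => ? [].
- by apply: sub AB2 _ _ => ? [].
- by apply: sub AB3 _ _ => ? [].
have [g gP] := conj_supported oV oU V0 U0 fV.
exists (g * f * g^-1)%g; split=> //; first by move/conjg1.
by exists (b g p); rewrite act_conj fp.
Qed.

(** If [U] were the single point [x], [ep] would collapse everything but [x] to [x], although at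
    least two of [x1], [x2], [x3] differ from [x]. *)
Lemma open_two_points (U : set X) : open U -> U !=set0 ->
  forall x, exists2 y, U y & y <> x.
Proof.
move=> oU U0 x; apply: contrapT => H.
have Ux y : U y -> y = x by move=> Uy; apply: contrapT => yx; apply: H; exists y.
have [g gP] := ep oU oU U0 U0.
have gx y : y <> x -> a g y = x by move=> yx; apply/Ux/gP => /Ux.
have inj y z : y <> z -> y <> x -> z <> x -> False.
  by move=> yz /gx yx /gx zx; apply/yz/(act_inj (a := a) (g := g)); rewrite yx zx.
have [e1|n1] := pselect (x1 = x); first by apply: (inj x2 x3); congruence.
have [e2|n2] := pselect (x2 = x); first by apply: (inj x1 x3); congruence.
by apply: (inj x1 x2).
Qed.

Lemma open_disjoint2 (U V : set X) : open U -> open V -> U !=set0 -> V !=set0 ->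
  exists U' V', [/\ [/\ open U', U' !=set0 & U' `<=` U],
    [/\ open V', V' !=set0 & V' `<=` V] & U' `&` V' = set0].
Proof.
move=> oU oV [x Ux] V0; have [y Vy yx] := open_two_points oV V0 x.
have [A [B [oA oB Ay Bx AB]]] := hausdorff_separate hX yx.
exists (U `&` B), (V `&` A); split.
- by split; [exact: openI|exists x|exact: subIsetl].
- by split; [exact: openI|exists y|exact: subIsetl].
by apply/disjointP => z [_ Bz] [_ Az]; move/disjointP: AB; apply; eassumption.
Qed.

Lemma open_disjoint3 (V : 'I_3 -> set X) :
  (forall i, open (V i) /\ V i !=set0) -> exists D : 'I_3 -> set X,
    (forall i, [/\ open (D i), D i !=set0 & D i `<=` V i]) /\
    forall i j, i <> j -> D i `&` D j = set0.
Proof.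
move=> oV.
have [oV0 n0] := oV ord0; have [oV1 n1] := oV (Ordinal (isT : 1 < 3)%N).
have [oV2 n2] := oV (Ordinal (isT : 2 < 3)%N).
have [A0 [A1 [[oA0 nA0 sA0] [oA1 nA1 sA1] A01]]] := open_disjoint2 oV0 oV1 n0 n1.
have [B0 [B2 [[oB0 nB0 sB0] [oB2 nB2 sB2] B02]]] := open_disjoint2 oA0 oV2 nA0 n2.
have [C1 [C2 [[oC1 nC1 sC1] [oC2 nC2 sC2] C12]]] := open_disjoint2 oA1 oB2 nA1 nB2.
exists (fun i => if val i == 0%N then B0 else if val i == 1%N then C1 else C2).
have D01 : B0 `&` C1 = set0.
  by apply/disjointP => z /sB0 ? /sC1 ?; move/disjointP: A01; apply; eassumption.
have D02 : B0 `&` C2 = set0.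
  by apply/disjointP => z ? /sC2 ?; move/disjointP: B02; apply; eassumption.
split.
  move=> [[|[|[|//]]] i] /=.
  - rewrite (_ : Ordinal i = ord0); last exact: val_inj.
    by split=> // ? /sB0/sA0.
  - rewrite (_ : Ordinal i = Ordinal (isT : 1 < 3)%N); last exact: val_inj.
    by split=> // ? /sC1/sA1.
  - rewrite (_ : Ordinal i = Ordinal (isT : 2 < 3)%N); last exact: val_inj.
    by split=> // ? /sC2/sB2.
by move=> [[|[|[|//]]] i] [[|[|[|//]]] j] //= ne; rewrite 1?setIC//;
  case: ne; exact: val_inj.
Qed.

Lemma exists_rigid_triple (V : 'I_3 -> set X) :
  (forall i, open (V i) /\ V i !=set0) ->
  exists (W : 'I_3 -> set X) (f : 'I_3 -> G) (p : 'I_3 -> T),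
    injective p /\ forall i,
      [/\ W i `<=` V i, supported a (W i) (f i), b (f i) (p i) <> p i,
        exists q, b (f i) q = q &
        forall Q, Q `&` V i = set0 -> noncrossing a (W i) Q].
Proof.
move=> /open_disjoint3[D [DV Ddisj]].
have /choice[W WP] : forall i, exists W : set X, [/\ open W, W !=set0, W `<=` D i &
    forall Q, Q `&` D i = set0 -> noncrossing a W Q].
  by move=> i; have [oD D0 _] := DV i; exact: shrink.
have /choice[f fP] : forall i, exists f,
    [/\ f <> 1%g, supported a (W i) f & exists p, b f p = p].
  by move=> i; have [oW W0 _ _] := WP i; exact: exists_supported_fixing.
have /choice[p pP] : forall i, exists p, b (f i) p <> p.
  by move=> i; have [f1 _ _] := fP i; exact: faithful_moved.
exists W, f, p; split=> [i j pij|i].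
  (* If [p i = p j] for [i <> j], then [f i] and [f j] move a common point of [T], while their
     supports in [X] are disjoint and do not cross. *)
  apply: contrapT => /Ddisj dij.
  have [_ Wfi [qi Hi]] := fP i; have [_ Wfj [qj Hj]] := fP j.
  have [_ _ WDi nc] := WP i; have [_ _ WDj _] := WP j.
  apply: (supports_disjoint fa tb _ _ Wfi Wfj Hi Hj (pP i)).
  - by apply/disjointP => z /WDi ? /WDj ?; move/disjointP: dij; apply; eassumption.
  - apply: nc; apply/disjointP => z /WDj ? ?; move/disjointP: dij; apply; eassumption.
  - by rewrite pij.
have [_ Wf Hq] := fP i; have [_ _ WD nc] := WP i; have [_ _ sDV] := DV i.
split=> //; first exact: subset_trans WD sDV.
move=> Q QV; apply: nc; apply/disjointP => z Qz /sDV Vz.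
by move/disjointP: QV; apply; eassumption.
Qed.

Theorem topologically_3_transitive : topologically_k_transitive 3 a.
Proof.
move=> U U' oU oU' [w Uw] [w' Uw'].
have [V [Vw VU]] := open_ptws_box oU Uw.
have [V' [Vw' VU']] := open_ptws_box oU' Uw'.
have [|W [f [p [pI WP]]]] := @exists_rigid_triple V.
  by move=> i; have [] := Vw i; split=> //; exists (w i).
have [|W' [f' [p' [pI' WP']]]] := @exists_rigid_triple V'.
  by move=> i; have [] := Vw' i; split=> //; exists (w' i).
have [g gP] := tb pI pI'.
have /choice[y yP] : forall i, exists y, V i y /\ V' i (a g y).
  (* Otherwise [g W_i] misses [V'_i], so it is disjoint from [W'_i] and does not cross it; yet the
     conjugate of [f i] by [g] and [f' i] both move [p' i], the image of [p i] under [g]. *)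
  move=> i; apply: contrapT => H.
  have [WV Wf fp [q fq] nc] := WP i; have [WV' Wf' fp' [q' fq'] nc'] := WP' i.
  have VV : (a g @` W i) `&` V' i = set0.
    by apply/disjointP => _ [z Wz <-] Vz; apply: H; exists z; split=> //; exact: WV.
  have Fq : b (g * f i * g^-1)%g (b g q) = b g q by rewrite act_conj fq.
  apply: (supports_disjoint fa tb _ (nc' _ VV) Wf' (supported_conj (g := g) Wf)
    fq' Fq fp').
  - by apply/disjointP => z /WV' ? ?; move/disjointP: VV; apply; eassumption.
  by rewrite -gP act_conj => /(act_inj (a := b)).
exists g, (diag_action 3 a g y); split.
  by exists y => //; apply: VU => i; have [] := yP i.
by apply: VU' => i; have [] := yP i.
Qed.

End TopologicalTransitivity.

(** * Gromov products and the boundary *)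

Section GromovProduct.
Variables (R : realType) (S : metricType R).
Implicit Types o p q x y : S.

Lemma gromov_product_ge0 o p q : 0 <= gromov_product o p q.
Proof.
rewrite /gromov_product; have := metric_triangle p o q.
by rewrite (metric_sym o q); lra.
Qed.

Lemma gromov_product_le o p q : gromov_product o p q <= mdist p o.
Proof.
rewrite /gromov_product; have := metric_triangle q p o.
by rewrite (metric_sym q p); lra.
Qed.

Lemma gromov_product_id o p : gromov_product o p p = mdist p o.
Proof. by rewrite /gromov_product mdistxx; lra. Qed.

(** In a tree the two products are the distances from [o] and [p] to the centre of the triangle.
    Below, this turns a small product seen from [A g o] into a large one seen from [o], and
    conversely. *)
Lemma gromov_product_swap o p q :
  gromov_product o p q + gromov_product p o q = mdist p o.
Proof.
rewrite /gromov_product (metric_sym o p) (metric_sym q p) (metric_sym q o).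
lra.
Qed.

End GromovProduct.

Section BoundaryPoints.
Variables (R : realType) (S : hyperbolicSpace R).
Implicit Types (o p q : S) (a b c : boundary S) (x y z : nat -> S).

Definition eventually2 (P : nat -> nat -> Prop) :=
  exists N, forall i j, (N <= i)%N -> (N <= j)%N -> P i j.

Lemma eventually2_and P Q : eventually2 P -> eventually2 Q ->
  eventually2 (fun i j => P i j /\ Q i j).
Proof.
move=> [M PM] [N QN]; exists (maxn M N) => i j; rewrite !geq_max.
by move=> /andP[Mi Ni] /andP[Mj Nj]; split; [exact: PM|exact: QN].
Qed.

Lemma gromov_equiv1 o x y :
  (forall r, eventually2 (fun i j => r < gromov_product o (x i) (y j))) ->
  gromov_equiv x y.
Proof.
move=> H; apply/gromov_equivP => o' r.
have [N /= HN] := H (r + mdist o' o); exists N => i j Ni Nj.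
have := HN i j Ni Nj; have := gromov_product_base o' o (x i) (y j); lra.
Qed.

Lemma seqs_toE a x y : seqs_to a x -> (seqs_to a y <-> gromov_equiv x y).
Proof.
move=> ax; split; first exact: seqs_to_equiv.
have [z _ aE] := seqs_toP a; move: ax; rewrite aE => -[_ zx] xy; split.
  exact: (gromov_equiv_trans (gromov_equiv_sym xy)).
exact: gromov_equiv_trans xy.
Qed.

Lemma boundary_eq_equiv a b x y :
  seqs_to a x -> seqs_to b y -> gromov_equiv x y -> a = b.
Proof.
move=> ax byy xy; apply: boundary_eq; apply/seteqP; split=> z.
  rewrite (seqs_toE _ ax) (seqs_toE _ byy).
  exact: gromov_equiv_trans (gromov_equiv_sym xy).
rewrite (seqs_toE _ ax) (seqs_toE _ byy).
exact: gromov_equiv_trans.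
Qed.

Lemma seqs_to_large o a x y r : seqs_to a x -> seqs_to a y ->
  eventually2 (fun i j => r < gromov_product o (x i) (y j)).
Proof. by move=> ax ay; exact: (gromov_equivP _ _).1 (seqs_to_equiv ax ay) o r. Qed.

Variable d : R.
Hypothesis d0 : (0 : R) <= d.
Hypothesis hd : forall x y z o : S,
  Num.min (gromov_product o x z) (gromov_product o z y) - d
    <= gromov_product o x y.

(** The four-point inequality as a disjunction, which case analysis and linear arithmetic can use
    directly. *)
Lemma gromov_product_or o p q r :
  gromov_product o p r - d <= gromov_product o p q \/
  gromov_product o r q - d <= gromov_product o p q.
Proof.
have := hd p q r o; rewrite minEle; case: ifP => _ H; by [left|right].
Qed.

(** If larger products occurred arbitrarily far out, passing through [x k] and [y l] would give
    products above [r + 1] for all representatives, at the cost of [d] twice. The [1] makes the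
    bound on the infimum strict. *)
Lemma boundary_ballN o a b r x y : ~ boundary_ball o a r b ->
  seqs_to a x -> seqs_to b y ->
  eventually2 (fun i j => gromov_product o (x i) (y j) <= r + 1 + 2 * d).
Proof.
move=> nab ax byy; apply: contrapT => H; apply: nab.
apply: (@lt_le_trans _ _ (r + 1)%:E); first by rewrite lte_fin; have := d0; lra.
apply: boundary_product_ge => x' y' ax' by'.
have [N1 /= H1] := seqs_to_large o (r + 1 + 2 * d) ax' ax.
have [N2 /= H2] := seqs_to_large o (r + 1 + 2 * d) byy by'.
exists (maxn N1 N2) => i j; rewrite !geq_max => /andP[Ni _] /andP[_ Nj].
have [[k l] [/= Nk Nl kl]] : exists kl : nat * nat,
    [/\ (maxn N1 N2 <= kl.1)%N, (maxn N1 N2 <= kl.2)%N &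
    r + 1 + 2 * d < gromov_product o (x kl.1) (y kl.2)].
  apply: contrapT => H'; apply: H; exists (maxn N1 N2) => k l Nk Nl.
  by rewrite leNgt; apply/negP => kl; apply: H'; exists (k, l).
move: Nk Nl; rewrite !geq_max => /andP[Nk _] /andP[_ Nl].
have := H1 i k Ni Nk; have := H2 l j Nl Nj.
have := gromov_product_or o (x' i) (y' j) (x k).
have := gromov_product_or o (x k) (y' j) (y l).
case=> ?; case=> ?; have := d0; lra.
Qed.

Lemma boundary_ball_intro o a b r x y : seqs_to a x -> seqs_to b y ->
  eventually2 (fun i j => r + 1 + 2 * d < gromov_product o (x i) (y j)) ->
  boundary_ball o a r b.
Proof.
move=> ax byy xy; apply: contrapT => /boundary_ballN/(_ ax byy).
move=> /(eventually2_and xy)[N /(_ N N (leqnn _) (leqnn _))]; have := d0; lra.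
Qed.

Lemma boundary_neq o a b : a <> b -> exists2 r, 0 <= r & ~ boundary_ball o a r b.
Proof.
move=> ab; apply: contrapT => H; apply: ab.
have [x ax] := seqs_to_nonempty a; have [y byy] := seqs_to_nonempty b.
apply: (boundary_eq_equiv ax byy); apply: (@gromov_equiv1 o) => r.
suff ab : boundary_ball o a (Num.max 0 r) b.
  have [N HN] := boundary_product_gt ab ax byy; exists N => i j Ni Nj.
  by apply: le_lt_trans (HN i j Ni Nj); rewrite le_max lexx orbT.
by apply: contrapT => nab; apply: H; exists (Num.max 0 r); rewrite // le_max lexx.
Qed.

(** The constant is uniform in the sequences because [axis_side] also needs it for their
    translates. *)
Lemma distinct_bound o a b : a <> b -> exists2 c, 0 <= c &
  forall x y, seqs_to a x -> seqs_to b y ->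
    eventually2 (fun i j => gromov_product o (x i) (y j) <= c).
Proof.
move=> /(boundary_neq o)[r r0 nab]; exists (r + 1 + 2 * d); first by have := d0; lra.
by move=> x y; exact: boundary_ballN.
Qed.

Lemma boundary_ball_disjoint o a b r c : ~ boundary_ball o a r b ->
  boundary_ball o a (r + 1 + 3 * d) c -> boundary_ball o b (r + 1 + 3 * d) c ->
  False.
Proof.
move=> nab ac bc.
have [x ax] := seqs_to_nonempty a; have [y byy] := seqs_to_nonempty b.
have [z cz] := seqs_to_nonempty c.
have [N1 /= H1] := boundary_product_gt ac ax cz.
have [N2 /= H2] := boundary_product_gt bc byy cz.
have [N3 /= H3] := boundary_ballN nab ax byy.
pose N := maxn N1 (maxn N2 N3).
have L1 : (N1 <= N)%N by rewrite leq_maxl.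
have L2 : (N2 <= N)%N by rewrite /N maxnCA leq_maxl.
have L3 : (N3 <= N)%N by rewrite /N maxnA leq_maxr.
have := H1 N N L1 L1; have := H2 N N L2 L2; have := H3 N N L3 L3.
have := gromov_product_or o (x N) (y N) (z N).
rewrite (gromov_productC o (y N)); case=> ?; have := d0; lra.
Qed.

(* The difference of the two sides is twice the combination
   (x|x') + (y|y') - (x|y) - (x'|y') of Gromov products, which does not depend on
   the base point. *)
Lemma cross_ratio_lt o b r a1 a2 c1 c2 x x' y y' :
  boundary_ball o b (r + 2 + 6 * d) a1 -> boundary_ball o b (r + 2 + 6 * d) a2 ->
  ~ boundary_ball o b r c1 -> ~ boundary_ball o b r c2 ->
  seqs_to a1 x -> seqs_to a2 x' -> seqs_to c1 y -> seqs_to c2 y' ->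
  eventually2 (fun n _ => mdist (x n) (x' n) + mdist (y n) (y' n) <
    mdist (x n) (y n) + mdist (x' n) (y' n)).
Proof.
move=> ba1 ba2 bc1 bc2 ax ax' cy cy'.
have [z bz] := seqs_to_nonempty b.
have := boundary_ballN bc1 bz cy; have := boundary_ballN bc2 bz cy'.
move=> /eventually2_and H /H{H}.
move=> /(eventually2_and (boundary_product_gt ba1 bz ax)).
move=> /(eventually2_and (boundary_product_gt ba2 bz ax'))[N /= HN].
exists N => n _ Nn _; have [Hx' [Hx [Hy' Hy]]] := HN n n Nn Nn.
(* With products based at [o]: (x|y) <= (z|y) + d and (x'|y') <= (z|y') + d, while (y|y') is at
   least the smaller of (z|y), (z|y') minus [d]. The larger of these two is at most [r + 1 + 2 * d],
   and (x|x') > [r + 2 + 5 * d], which leaves a margin of 1. *)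
have := gromov_product_or o (z n) (y n) (x n).
have := gromov_product_or o (z n) (y' n) (x' n).
have := gromov_product_or o (x n) (x' n) (z n).
have := gromov_product_or o (y n) (y' n) (z n).
rewrite (gromov_productC o (x n) (z n)) (gromov_productC o (y n) (z n)).
suff : 0 < gromov_product o (x n) (x' n) + gromov_product o (y n) (y' n) -
    gromov_product o (x n) (y n) - gromov_product o (x' n) (y' n) ->
    mdist (x n) (x' n) + mdist (y n) (y' n) <
    mdist (x n) (y n) + mdist (x' n) (y' n).
  by move=> H; case=> ?; case=> ?; case=> ?; case=> ?; apply: H; have := d0; lra.
by rewrite /gromov_product; have := d0; lra.
Qed.

(** A lower bound for the Gromov product of [p] with the limit of [x], expressed through a
    representative since [boundary_product] pairs only boundary points. *)
Definition toward o x p M := exists N, forall i, (N <= i)%N ->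
  M <= gromov_product o (x i) p.

Lemma towardW o x p M M' : M' <= M -> toward o x p M -> toward o x p M'.
Proof.
by move=> MM [N HN]; exists N => i /HN; exact: le_trans.
Qed.

Lemma toward0 o x p M : M <= 0 -> toward o x p M.
Proof.
by move=> M0; exists 0%N => i _; apply: le_trans M0 (gromov_product_ge0 _ _ _).
Qed.

Lemma toward_separated o x y p q M (c : R) : toward o x p M -> toward o y q M ->
  eventually2 (fun i j => gromov_product o (x i) (y j) <= c) ->
  c + 2 * d < M -> gromov_product o p q <= c + 2 * d.
Proof.
move=> [N1 /= H1] [N2 /= H2] [N3 /= H3] cM.
pose N := maxn N1 (maxn N2 N3).
have L1 : (N1 <= N)%N by rewrite leq_maxl.
have L2 : (N2 <= N)%N by rewrite /N maxnCA leq_maxl.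
have L3 : (N3 <= N)%N by rewrite /N maxnA leq_maxr.
have := H1 N L1; have := H2 N L2; have := H3 N N L3 L3.
have := gromov_product_or o (x N) (y N) p.
have := gromov_product_or o p (y N) q.
rewrite (gromov_productC o q (y N)); case=> ?; case=> ?; have := d0; lra.
Qed.

Lemma toward_seqs_to o a x (w : nat -> S) : seqs_to a x ->
  (forall n, toward o x (w n) n%:R) -> seqs_to a w.
Proof.
move=> ax xw; apply/(seqs_toE _ ax)/(@gromov_equiv1 o) => r.
have [N /= HN] := seqs_to_large o (r + d) ax ax.
have [M rM] : exists M, r + d < M%:R.
  exists (Num.bound `|r + d|).
  exact: le_lt_trans (ler_norm _) (archi_boundP (normr_ge0 _)).
exists (maxn N M) => i n; rewrite !geq_max => /andP[Ni _] /andP[_ Mn].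
have [K HK] := xw n.
pose k := maxn N K.
have := HN i k Ni (leq_maxl _ _); have := HK k (leq_maxr _ _).
have : (M%:R : R) <= n%:R by rewrite ler_nat.
have := gromov_product_or o (x i) (w n) (x k); case=> ?; have := d0; lra.
Qed.

End BoundaryPoints.

(** * Isometric actions *)

(** Each of two obstructions rules out at most one of three candidates. *)
Lemma disjoint_bad_choice (P1 P2 P3 Q1 Q2 Q3 : Prop) :
  ~ (P1 /\ P2) -> ~ (P1 /\ P3) -> ~ (P2 /\ P3) ->
  ~ (Q1 /\ Q2) -> ~ (Q1 /\ Q3) -> ~ (Q2 /\ Q3) ->
  [\/ ~ P1 /\ ~ Q1, ~ P2 /\ ~ Q2 | ~ P3 /\ ~ Q3].
Proof.
have [p1|p1] := pselect P1; have [p2|p2] := pselect P2;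
  have [p3|p3] := pselect P3; have [q1|q1] := pselect Q1;
  have [q2|q2] := pselect Q2; have [q3|q3] := pselect Q3; try tauto;
  move=> *; by [constructor 1|constructor 2|constructor 3].
Qed.

Section IsometricAction.
Variables (R : realType) (G : groupType) (S : hyperbolicSpace R).
Variable A : isometric_action G S.
Implicit Types (o p q : S) (a b c : boundary S) (x y z : nat -> S).

Lemma mdist_actV g o : mdist o (A g^-1%g o) = mdist o (A g o).
Proof. by rewrite -(isometric_actP A g o (A g^-1%g o)) actVK metric_sym. Qed.

Lemma gromov_product_actV g o p q :
  gromov_product (A g o) p q = gromov_product o (A g^-1%g p) (A g^-1%g q).
Proof. by rewrite -(gromov_product_act A g o) !actVK. Qed.

Lemma seqs_to_act g a x : seqs_to a x ->
  seqs_to (boundary_action A g a) (A g \o x).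
Proof. by move=> ax; exists x. Qed.

Lemma fixed_inv g a : boundary_action A g a = a -> boundary_action A g^-1%g a = a.
Proof. by move=> ga; rewrite -{1}ga actK. Qed.

Lemma seqs_to_orbit (u : nat -> G) (s o : S) a :
  seqs_to a (fun n => A (u n) s) -> seqs_to a (fun n => A (u n) o).
Proof.
move=> as_; apply/(seqs_toE _ as_)/(@gromov_equiv1 _ _ s) => r.
have [N /= HN] := seqs_to_large s (r + mdist s o) as_ as_.
exists N => i j Ni Nj; have := HN i j Ni Nj.
rewrite /gromov_product.
have := metric_triangle (A (u j) s) (A (u j) o) s.
have := metric_triangle (A (u i) s) (A (u j) s) (A (u j) o).
rewrite !isometric_actP.
have := metric_triangle (A (u i) s) (A (u j) o) (A (u j) s).
rewrite isometric_actP (metric_sym o s); lra.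
Qed.

Variable d : R.
Hypothesis d0 : (0 : R) <= d.
Hypothesis hd : forall x y z o : S,
  Num.min (gromov_product o x z) (gromov_product o z y) - d
    <= gromov_product o x y.
Let hor o (p q r : S) := gromov_product_or hd o p q r.

(** As [u] fixes [a] and [b], the product of [x] and [y] is bounded by [c] from [A u o] as well as
    from [o]. If [A u o] lay toward neither side, then by [gromov_product_swap] both [x] and [y]
    would have products above [c + d] with [o] seen from [A u o], so (x|y) would exceed [c]
    there. *)
Lemma axis_side o a b x y : a <> b -> seqs_to a x -> seqs_to b y ->
  exists2 C, 0 <= C & forall u,
    boundary_action A u a = a -> boundary_action A u b = b ->
    toward o x (A u o) (mdist o (A u o) - C) \/
    toward o y (A u o) (mdist o (A u o) - C).
Proof.
move=> ab ax byy; have [c c0 cab] := distinct_bound d0 hd o ab.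
exists (c + 2 * d); first by have := d0; lra.
move=> u ua ub; set D := mdist o (A u o).
have uax : seqs_to a (A u^-1%g \o x) by rewrite -[a](fixed_inv ua); exact: seqs_to_act.
have uby : seqs_to b (A u^-1%g \o y) by rewrite -[b](fixed_inv ub); exact: seqs_to_act.
(* Products between late terms exceed [D], so a bound at index [N] passes to all later indices at
   the cost of one more [d]. *)
have [N /= HN] := eventually2_and
  (eventually2_and (cab _ _ ax byy) (cab _ _ uax uby))
  (eventually2_and (seqs_to_large o D ax ax) (seqs_to_large o D byy byy)).
have [[H1 H2] _] := HN N N (leqnn _) (leqnn _).
move: H2; rewrite /= -gromov_product_actV => H2.
have Dx := gromov_product_swap (A u o) o (x N).
have Dy := gromov_product_swap (A u o) o (y N).
have [sx|sy] : D - c - d <= gromov_product o (x N) (A u o) \/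
    D - c - d <= gromov_product o (y N) (A u o).
  move: Dx Dy H1 H2; rewrite -/D.
  have := hor o (x N) (y N) (A u o).
  have := hor (A u o) (x N) (y N) o.
  rewrite !(gromov_productC o _ (x N)) !(gromov_productC (A u o) _ (x N)).
  rewrite !(gromov_productC o (A u o) (y N)).
  case=> ?; case=> ? ? ? ? ?; have := d0; [left|left|right|right]; lra.
- left; exists N => i Ni; have [_ [+ _]] := HN i N Ni (leqnn _).
  have := hor o (x i) (A u o) (x N); case=> ?; have := d0; lra.
- right; exists N => i Ni; have [_ [_ +]] := HN i N Ni (leqnn _).
  have := gromov_product_le o (A u o) (y N).
  rewrite (metric_sym _ o) -/D (gromov_productC _ _ (y N)).
  have := hor o (y i) (A u o) (y N); case=> ?; have := d0; lra.
Qed.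


(** Translating the first bound by the inverse of [u] gives (u^-1 x|u^-1 o) <= [C] at [o]. As u^-1 x
    also tends to [a], the second bound makes this product at least [D - C - d]. *)
Lemma same_side o a x u C : 0 <= C -> seqs_to a x -> boundary_action A u a = a ->
  toward o x (A u o) (mdist o (A u o) - C) ->
  toward o x (A u^-1%g o) (mdist o (A u o) - C) ->
  mdist o (A u o) <= 2 * C + d.
Proof.
set D := mdist o (A u o) => C0 ax ua [N1 H1] [N2 H2].
have uax : seqs_to a (A u^-1%g \o x) by rewrite -[a](fixed_inv ua); exact: seqs_to_act.
have [N3 /= H3] := seqs_to_large o D uax ax.
pose N := maxn N1 (maxn N2 N3).
have L1 : (N1 <= N)%N by rewrite leq_maxl.
have L2 : (N2 <= N)%N by rewrite /N maxnCA leq_maxl.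
have L3 : (N3 <= N)%N by rewrite /N maxnA leq_maxr.
have := H1 N L1; have := H2 N L2; have := H3 N N L3 L3.
have := gromov_product_swap (A u o) o (x N); rewrite -/D.
have := gromov_product_actV u o o (x N).
rewrite (gromov_productC o (A u o)) (gromov_productC o _ (A u^-1%g (x N))) => ->.
have := hor o (A u^-1%g (x N)) (A u^-1%g o) (x N).
by case=> ?; have := d0; lra.
Qed.

(** By [same_side], [u] and its inverse push [o] to opposite ends unless [D] is at most [2 * C + d];
    in that case the bounds required are nonpositive and hold trivially. *)
Lemma axis o a b x y : a <> b -> seqs_to a x -> seqs_to b y ->
  exists2 C, 0 <= C & forall u,
    boundary_action A u a = a -> boundary_action A u b = b ->
    let D := mdist o (A u o) in
    toward o x (A u o) (D - C) /\ toward o y (A u^-1%g o) (D - C) \/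
    toward o y (A u o) (D - C) /\ toward o x (A u^-1%g o) (D - C).
Proof.
move=> ab ax byy; have [C C0 HC] := axis_side o ab ax byy.
have C'0 : C <= 2 * C + d by have := d0; lra.
exists (2 * C + d); first by have := d0; lra.
move=> u ua ub D.
have small z : D <= 2 * C + d -> forall p, toward o z p (D - (2 * C + d)).
  by move=> DC p; apply: toward0; lra.
have DD : D - (2 * C + d) <= D - C by lra.
have := HC u ua ub; have := HC _ (fixed_inv ua) (fixed_inv ub).
rewrite mdist_actV -/D => -[xV|yV] [xu|yu].
- by left; split; apply: small; exact: (same_side C0 ax ua).
- by right; split; apply: (towardW DD).
- by left; split; apply: (towardW DD).
- by left; split; apply: small; exact: (same_side C0 byy ub).
Qed.

(** What is kept of a loxodromic element. Since [u] may depend on [L], no growth rate of the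
    displacements of its powers enters. *)
Definition axis_pair a b := a <> b /\ forall o L, exists u,
  [/\ boundary_action A u a = a, boundary_action A u b = b &
      L < mdist o (A u o)].

Lemma loxodromic_axis g : loxodromic A g -> exists a b,
  axis_pair a b /\ fixed_points (boundary_action A) g = [set a; b].
Proof.
move=> [unb [a [b [ab gE]]]]; exists a, b; split=> //; split=> // o L.
have [ga gb] : fixed_points (boundary_action A) g a /\
    fixed_points (boundary_action A) g b by rewrite gE; split; [left|right].
have powfix c h : boundary_action A g c = c -> cyclic_subgroup g h ->
    boundary_action A h c = c.
  move=> gc; have gnc n : boundary_action A (g ^+ n)%g c = c.
    by elim: n => [|n IH]; [exact: act1|rewrite expgS actM IH].
  by move=> [n [->|->]] //; exact: fixed_inv.
apply: contrapT => H; apply: (unb o); exists L => _ _ [h1 h1g <-] [h2 h2g <-].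
rewrite leNgt; apply/negP => Lh; apply: H; exists (h1^-1 * h2)%g; split.
- by rewrite actM (powfix a h2)// fixed_inv// powfix.
- by rewrite actM (powfix b h2)// fixed_inv// powfix.
by rewrite -(isometric_actP A h1) actM actVK.
Qed.

Lemma axis_pair_limit_set o a b : axis_pair a b ->
  limit_set A a /\ limit_set A b.
Proof.
move=> [ab H].
have [x ax] := seqs_to_nonempty a; have [y byy] := seqs_to_nonempty b.
have [C C0 HC] := axis o ab ax byy.
have /choice[w wP] : forall n : nat, exists w, toward o x (A w o) n%:R.
  move=> n; have [u [ua ub uL]] := H o (n%:R + C).
  have nD : n%:R <= mdist o (A u o) - C by lra.
  have [[xu _]|[_ xu]] := HC u ua ub.
    by exists u; exact: towardW xu.
  by exists u^-1%g; exact: towardW xu.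
have /choice[v vP] : forall n : nat, exists w, toward o y (A w o) n%:R.
  move=> n; have [u [ua ub uL]] := H o (n%:R + C).
  have nD : n%:R <= mdist o (A u o) - C by lra.
  have [[_ yu]|[yu _]] := HC u ua ub.
    by exists u^-1%g; exact: towardW yu.
  by exists u; exact: towardW yu.
split; [exists o, w|exists o, v].
  exact: (toward_seqs_to d0 hd ax wP).
exact: (toward_seqs_to d0 hd byy vP).
Qed.

Lemma ping_pong_triple o a b a' b' : axis_pair a b -> axis_pair a' b' ->
  a <> a' -> a <> b' -> b <> a' -> b <> b' ->
  exists2 C, 0 <= C & forall L, exists t1 t2 t3 : G,
    [/\ [/\ L <= mdist o (A t1 o), L <= mdist o (A t2 o) & L <= mdist o (A t3 o)],
      [/\ gromov_product o (A t1 o) (A t2 o) <= C,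
          gromov_product o (A t1 o) (A t3 o) <= C &
          gromov_product o (A t2 o) (A t3 o) <= C] &
      [/\ gromov_product o (A t1^-1%g o) (A t2^-1%g o) <= C,
          gromov_product o (A t1^-1%g o) (A t3^-1%g o) <= C &
          gromov_product o (A t2^-1%g o) (A t3^-1%g o) <= C]].
Proof.
move=> [ab H] [ab' H'] aa' a_b' b_a' bb'.
have [x ax] := seqs_to_nonempty a; have [y byy] := seqs_to_nonempty b.
have [x' ax'] := seqs_to_nonempty a'; have [y' by'] := seqs_to_nonempty b'.
have [C C0 HC] := axis o ab ax byy; have [C' C'0 HC'] := axis o ab' ax' by'.
have [c1 c10 /(_ _ _ ax byy) H1] := distinct_bound d0 hd o ab.
have [c2 c20 /(_ _ _ ax ax') H2] := distinct_bound d0 hd o aa'.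
have [c3 c30 /(_ _ _ ax by') H3] := distinct_bound d0 hd o a_b'.
have [c4 c40 /(_ _ _ byy ax') H4] := distinct_bound d0 hd o b_a'.
have [c5 c50 /(_ _ _ byy by') H5] := distinct_bound d0 hd o bb'.
pose c := c1 + c2 + c3 + c4 + c5.
have weak z z' e : e <= c ->
    eventually2 (fun i j => gromov_product o (z i) (z' j) <= e) ->
    eventually2 (fun i j => gromov_product o (z i) (z' j) <= c).
  move=> ec [N HN]; exists N => i j Ni Nj; exact: le_trans (HN i j Ni Nj) ec.
have {H1}K1 := weak _ _ c1 ltac:(rewrite /c; lra) H1.
have {H2}K2 := weak _ _ c2 ltac:(rewrite /c; lra) H2.
have {H3}K3 := weak _ _ c3 ltac:(rewrite /c; lra) H3.
have {H4}K4 := weak _ _ c4 ltac:(rewrite /c; lra) H4.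
have {H5}K5 := weak _ _ c5 ltac:(rewrite /c; lra) H5.
have c0 : 0 <= c by rewrite /c; lra.
exists (c + 2 * d); first by have := d0; lra.
move=> L; pose M := c + 2 * d + 1.
have cM : c + 2 * d < M by rewrite /M; lra.
have [u [ua ub uL]] := H o (`|L| + M + C).
have [v [va vb vL]] := H' o (`|L| + M + C').
have LL := ler_norm L; have L0 := normr_ge0 L.
have M0 : 0 <= M by rewrite /M; have := d0; lra.
have wu : M <= mdist o (A u o) - C by lra.
have wv : M <= mdist o (A v o) - C' by lra.
have sep z z' p q : toward o z p M -> toward o z' q M ->
    eventually2 (fun i j => gromov_product o (z i) (z' j) <= c) ->
    gromov_product o p q <= c + 2 * d.
  by move=> zp zq cz; exact: (toward_separated d0 hd zp zq cz cM).
exists u, u^-1%g, v; split; first by rewrite mdist_actV; split; lra.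
- have := HC u ua ub; have := HC' v va vb.
  move=> [] [/(towardW wv) V1 /(towardW wv) V2] [] [/(towardW wu) U1 /(towardW wu) U2].
  + by split; [exact: sep U1 U2 K1|exact: sep U1 V1 K2|exact: sep U2 V1 K4].
  + split; [|exact: sep U1 V1 K4|exact: sep U2 V1 K2].
    by rewrite gromov_productC; exact: sep U2 U1 K1.
  + by split; [exact: sep U1 U2 K1|exact: sep U1 V1 K3|exact: sep U2 V1 K5].
  + split; [|exact: sep U1 V1 K5|exact: sep U2 V1 K3].
    by rewrite gromov_productC; exact: sep U2 U1 K1.
- have := HC u ua ub; have := HC' v va vb; rewrite invgK.
  move=> [] [/(towardW wv) V1 /(towardW wv) V2] [] [/(towardW wu) U1 /(towardW wu) U2].
  + split; [|exact: sep U2 V2 K5|exact: sep U1 V2 K3].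
    by rewrite gromov_productC; exact: sep U1 U2 K1.
  + by split; [exact: sep U2 U1 K1|exact: sep U2 V2 K3|exact: sep U1 V2 K5].
  + split; [|exact: sep U2 V2 K4|exact: sep U1 V2 K2].
    by rewrite gromov_productC; exact: sep U1 U2 K1.
  + by split; [exact: sep U2 U1 K1|exact: sep U2 V2 K2|exact: sep U1 V2 K4].
Qed.

Lemma separate_directions o a b a' b' : axis_pair a b -> axis_pair a' b' ->
  a <> a' -> a <> b' -> b <> a' -> b <> b' ->
  exists2 C, 0 <= C & forall p q, exists2 t,
    mdist o (A t o) <= C & gromov_product o p (A t q) <= C.
Proof.
move=> ab ab' aa' a_b' b_a' bb'.
have [C C0 HC] := ping_pong_triple o ab ab' aa' a_b' b_a' bb'.
have [t1 [t2 [t3 [[L1 L2 L3] [P12 P13 P23] [Q12 Q13 Q23]]]]] := HC (2 * C + 4 * d + 1).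
pose E := C + 2 * d + mdist o (A t1 o) + mdist o (A t2 o) + mdist o (A t3 o).
have m1 := mdist_ge0 o (A t1 o); have m2 := mdist_ge0 o (A t2 o).
have m3 := mdist_ge0 o (A t3 o).
exists E; first by rewrite /E; have := d0; lra.
move=> p q.
have excl r s s' : gromov_product o s s' <= C ->
    ~ (C + d < gromov_product o s r /\ C + d < gromov_product o s' r).
  move=> ss' [sr s'r]; move: (hor o s s' r); rewrite (gromov_productC _ r).
  by move=> H; suff : C < C by [rewrite ltxx]; case: H => ?; lra.
have good t : 2 * C + 4 * d + 1 <= mdist o (A t o) ->
    ~ C + d < gromov_product o (A t o) p ->
    ~ C + d < gromov_product o (A t^-1%g o) q ->
    gromov_product o p (A t q) <= C + 2 * d.
  move=> Lt /negP; rewrite -leNgt => pt /negP; rewrite -leNgt => qt.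
  have := gromov_product_swap (A t o) o (A t q).
  rewrite gromov_product_actV !actK => e.
  move: (hor o p (A t o) (A t q)).
  rewrite (gromov_productC o p (A t o)) (gromov_productC o (A t q)).
  by move: e qt; have := d0; move=> ? ? ? [?|?]; lra.
case: (disjoint_bad_choice (excl p _ _ P12) (excl p _ _ P13) (excl p _ _ P23)
  (excl q _ _ Q12) (excl q _ _ Q13) (excl q _ _ Q23)) => -[bp bq].
- by exists t1; [|have := good _ L1 bp bq]; rewrite /E; have := d0; lra.
- by exists t2; [|have := good _ L2 bp bq]; rewrite /E; have := d0; lra.
- by exists t3; [|have := good _ L3 bp bq]; rewrite /E; have := d0; lra.
Qed.

End IsometricAction.

Section LimitSet.
Variables (R : realType) (G : groupType) (S : hyperbolicSpace R).
Variable A : isometric_action G S.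
Implicit Types (o p q : S) (a b c : boundary S) (x y z : nat -> S).

Lemma general_type_axes : general_type A -> exists a b a' b',
  [/\ axis_pair A a b, axis_pair A a' b' &
      [/\ a <> a', a <> b', b <> a' & b <> b']].
Proof.
move=> [_ [g [h [/loxodromic_axis[a [b [ab gE]]]
  /loxodromic_axis[a' [b' [ab' hE]]] /disjointP gh]]]].
exists a, b, a', b'; split=> //; move: gh; rewrite gE hE => gh.
by split=> e; [apply: (gh a)|apply: (gh a)|apply: (gh b)|apply: (gh b)];
  rewrite /= ?e; tauto.
Qed.

Lemma boundary_contraction o (xi eta : boundary S) r :
  general_type A -> limit_set A xi -> limit_set A eta -> 0 <= r ->
  exists g, forall a, ~ boundary_ball o xi r a ->
    boundary_ball o eta r (boundary_action A g a).
Proof.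
move=> gt [s [u xiu']] [s' [v etav']] r0.
have [d d0 hd] := hyperbolic_gromov S.
pose hor o (p q r : S) := gromov_product_or hd o p q r.
have [a [b [a' [b' [ab ab' [aa' a_b' b_a' bb']]]]]] := general_type_axes gt.
have [C C0 HC] := separate_directions d0 hd o ab ab' aa' a_b' b_a' bb'.
have xiu := seqs_to_orbit o xiu'; have etav := seqs_to_orbit o etav'.
pose r' := r + 1 + 2 * d; pose M := 2 * C + 2 * r' + 3 * d + 1.
have [N1 /= H1] := seqs_to_large o M xiu xiu.
have [N2 /= H2] := seqs_to_large o M etav etav.
set h := u N1 in H1; set k := v N2 in H2.
have [t tC tP] := HC (A k^-1%g o) (A h^-1%g o).
pose g := (k * (t * h^-1))%g.
have g_k : M - C <= gromov_product o (A k o) (A g o).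
  have := gromov_product_swap o (A k o) (A g o).
  rewrite gromov_product_actV /g actM actK actM => e.
  have := H2 N2 N2 (leqnn _) (leqnn _); rewrite gromov_product_id; lra.
have g_h : M - 2 * C <= gromov_product o (A h o) (A g^-1%g o).
  have := gromov_product_swap o (A h o) (A g^-1%g o).
  rewrite gromov_product_actV.
  have -> : A h^-1%g (A g^-1%g o) = A t^-1%g (A k^-1%g o).
    by rewrite /g !invgM invgK !actM actK.
  move=> e; have := gromov_product_base o (A t o) (A k^-1%g o) (A t (A h^-1%g o)).
  rewrite gromov_product_actV actK.
  rewrite (gromov_productC o (A t^-1%g _)) => e'.
  have := H1 N1 N1 (leqnn _) (leqnn _); rewrite gromov_product_id; lra.
exists g => c nc.
have [w cw] := seqs_to_nonempty c.
apply: (boundary_ball_intro d0 hd etav (seqs_to_act A g cw)) => /=.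
have [N3 /= H3] := boundary_ballN d0 hd nc xiu cw.
pose N := maxn N1 N3.
have NL1 : (N1 <= N)%N by rewrite leq_maxl.
have NL3 : (N3 <= N)%N by rewrite leq_maxr.
exists (maxn N2 N) => i j; rewrite !geq_max.
move=> /andP[Ni /andP[_ _]] /andP[_ /andP[_ Nj]].
have c1 : gromov_product o (A g^-1%g o) (w j) <= r' + d.
  have := H3 N j NL3 Nj.
  have : M < gromov_product o (A (u N) o) (A h o) by exact: H1.
  have := hor o (A (u N) o) (w j) (A g^-1%g o).
  have := hor o (A (u N) o) (A g^-1%g o) (A h o).
  by case=> ?; case=> ?; move: g_h; rewrite /M /r'; have := d0; lra.
have c2 : M - C - r' - d <= gromov_product o (A g o) (A g (w j)).
  have := gromov_product_swap o (A g o) (A g (w j)).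
  rewrite gromov_product_actV actK.
  have := gromov_product_le o (A g o) (A k o).
  rewrite (gromov_productC o (A g o)); lra.
have : M < gromov_product o (A (v i) o) (A k o) by exact: H2.
have := hor o (A (v i) o) (A g (w j)) (A g o).
have := hor o (A (v i) o) (A g o) (A k o).
by case=> ?; case=> ?; move: g_k c2; rewrite /M /r'; have := d0; lra.
Qed.

Lemma nbhs_limit_set o (p : limit_set A) (U : set (limit_set A)) :
  nbhs p U <-> exists2 r, 0 <= r &
    forall q : limit_set A, boundary_ball o (set_val p) r (set_val q) -> U q.
Proof.
split=> [|[r r0 rU]].
  rewrite nbhsE => -[V [[W oW <-] Wp] VU].
  have /boundary_nbhsE-/(_ o)[r r0 rW] : nbhs (set_val p) W.
    exact: open_nbhs_nbhs.
  by exists r => // q /rW/VU.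
have : nbhs (set_val p) (boundary_ball o (set_val p) r).
  by apply/(boundary_nbhsE o); exists r.
move=> /(@initial_continuous _ _ (@set_val _ (limit_set A)) p) pr.
have : nbhs p (set_val @^-1` boundary_ball o (set_val p) r) by exact: pr.
by apply: filterS => q; exact: rU.
Qed.

Lemma hausdorff_limit_set : hausdorff_space (limit_set A).
Proof.
move=> p q pq; apply: contrapT => npq.
have [d d0 hd] := hyperbolic_gromov S.
have [ o _] := boundary_base_point (set_val p).
have [|r r0 npqr] := boundary_neq o (a := set_val p) (b := set_val q).
  by move=> /val_inj.
have spos : 0 <= r + 1 + 3 * d by have := d0; lra.
have ball_nbhs w : nbhs w [set z : limit_set A |
    boundary_ball o (set_val w) (r + 1 + 3 * d) (set_val z)].
  by apply/(nbhs_limit_set o); exists (r + 1 + 3 * d).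
have [z [pz qz]] := pq _ _ (ball_nbhs p) (ball_nbhs q).
exact: (boundary_ball_disjoint d0 hd npqr pz qz).
Qed.

Lemma limit_action_continuous g : continuous (limit_action A g).
Proof.
move=> p U; have [ o _] := boundary_base_point (set_val p).
move=> /(nbhs_limit_set (A g o))[r r0 rU].
apply/(nbhs_limit_set o); exists r => // q pq; apply: rU.
exact/boundary_action_ball.
Qed.

Lemma limit_action_contraction (O U : set (limit_set A)) : general_type A ->
  open O -> open U -> O !=set0 -> U !=set0 ->
  exists g, forall w : limit_set A, ~ O w -> U (limit_action A g w).
Proof.
move=> gt oO oU [p Op] [q Uq]; have [ o _] := boundary_base_point (set_val p).
have [r r0 rO] := (nbhs_limit_set o _ _).1 (open_nbhs_nbhs (conj oO Op)).
have [s spos sU] := (nbhs_limit_set o _ _).1 (open_nbhs_nbhs (conj oU Uq)).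
have rs0 : 0 <= Num.max r s by rewrite le_max r0.
have [g gP] := boundary_contraction o gt (set_valP p) (set_valP q) rs0.
exists g => z nOz; apply: sU.
apply: (boundary_ballS (_ : s <= Num.max r s)); first by rewrite le_max lexx orbT.
apply: gP => zp; apply/nOz/rO.
by apply: boundary_ballS zp; rewrite le_max lexx.
Qed.

Lemma limit_set_shrink (U : set (limit_set A)) : open U -> U !=set0 ->
  exists V : set (limit_set A), [/\ open V, V !=set0, V `<=` U &
    forall Q, Q `&` U = set0 -> noncrossing (limit_action A) V Q].
Proof.
move=> oU [p Up]; have [ o _] := boundary_base_point (set_val p).
have [d d0 hd] := hyperbolic_gromov S.
have [r r0 rU] := (nbhs_limit_set o _ _).1 (open_nbhs_nbhs (conj oU Up)).
pose B := [set q : limit_set A | boundary_ball o (set_val p) (r + 2 + 6 * d) (set_val q)].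
have BU : B `<=` U.
  move=> q Bq; apply: rU; apply: boundary_ballS Bq; have := d0; lra.
exists (interior B); split.
- exact: open_interior.
- exists p; apply/(nbhs_limit_set o); exists (r + 2 + 6 * d) => //.
  by have := d0; lra.
- exact: subset_trans (@interior_subset _ B) BU.
move=> Q /disjointP QU g.
have far (w : limit_set A) : Q w -> ~ boundary_ball o (set_val p) r (set_val w).
  by move=> Qw /rU; exact: QU.
have near (w : limit_set A) : interior B w ->
    boundary_ball o (set_val p) (r + 2 + 6 * d) (set_val w).
  by move=> /interior_subset.
move=> [[_ [[p1 Vp1 <-] /near gp1]] [_ [[p2 Vp2 <-] /far gp2]]
  [_ [[q1 Qq1 <-] /near gq1]] [_ [[q2 Qq2 <-] /far gq2]]].
have [x1 px1] := seqs_to_nonempty (set_val p1).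
have [x2 px2] := seqs_to_nonempty (set_val p2).
have [y1 qy1] := seqs_to_nonempty (set_val q1).
have [y2 qy2] := seqs_to_nonempty (set_val q2).
have [N HN] := eventually2_and
  (cross_ratio_lt d0 hd (near _ Vp1) (near _ Vp2) (far _ Qq1) (far _ Qq2)
    px1 px2 qy1 qy2)
  (cross_ratio_lt d0 hd gp1 gq1 gp2 gq2 (seqs_to_act A g px1)
    (seqs_to_act A g qy1) (seqs_to_act A g px2) (seqs_to_act A g qy2)).
have [/= H] := HN N N (leqnn _) (leqnn _).
by rewrite !isometric_actP => H'; move: (lt_trans H H'); rewrite ltxx.
Qed.

End LimitSet.

Lemma transitivity_degree_attained (R : realType) (G : groupType) (n : nat) :
  transitivity_degree R G = n.+1%:R%:E ->
  exists (Omega : Type) (b : group_action G Omega),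
    faithful_action b /\ k_transitive n.+1 b.
Proof.
move=> dG.
have : (n%:R%:E < transitivity_degree R G)%E by rewrite dG lte_fin ltr_nat.
move=> /ereal_sup_gt[_ [k kP <-]]; rewrite lte_fin ltr_nat => nk.
have : (k%:R%:E <= transitivity_degree R G)%E.
  by apply: ereal_sup_ubound; exists k.
rewrite dG lee_fin ler_nat => kn.
by have -> : n.+1 = k by apply/eqP; rewrite eqn_leq nk kn.
Qed.

Local Open Scope ereal_scope.

Theorem corollary1p11 (R : realType) (G : groupType)
    (G_fwh : faithful_weakly_hyperbolic R G)
    (G_not_lim_free : ~ lim_free R G)
    (G_degree : transitivity_degree R G = 3%:E)
    (S : hyperbolicSpace R) (A : isometric_action G S)
    (A_general_type : general_type A)
    (A_faithful : faithful_action (limit_action A)) :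
  topologically_k_transitive 3 (limit_action A).
Proof.
have [T [b [fb tb]]] := transitivity_degree_attained (n := 2) G_degree.
have [f f1 fixf] : exists2 f, f <> 1%g &
    interior (fixed_points (limit_action A) f) !=set0.
  apply: contrapT => H; apply: G_not_lim_free; exists S, A; split=> // f /eqP f1.
  apply: contrapT => /eqP/set0P fx; apply: H; exists f => //.
have [a [b1 [a' [b' [ab ab' [aa' a_b' b_a' _]]]]]] := general_type_axes A_general_type.
have [ o _] := boundary_base_point a.
have [d d0 hd] := hyperbolic_gromov S.
have [la lb] := axis_pair_limit_set d0 hd o ab.
have [la' _] := axis_pair_limit_set d0 hd o ab'.
have toL c (lc : limit_set A c) : exists p : limit_set A, set_val p = c.
  by exists (exist _ c (mem_set lc)).
have [p1 e1] := toL _ la; have [p2 e2] := toL _ lb; have [p3 e3] := toL _ la'.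
apply: (topologically_3_transitive (@hausdorff_limit_set _ _ _ A)
  (@limit_action_continuous _ _ _ A) A_faithful _
  (@limit_set_shrink _ _ _ A) (x1 := p1) (x2 := p2) (x3 := p3) _ _ _ f1
  (@open_interior _ _) fixf _ fb tb).
- by move=> O U; exact: limit_action_contraction.
- by move=> e; case: ab => + _; apply; rewrite -e1 -e2 e.
- by move=> e; apply: aa'; rewrite -e1 -e3 e.
- by move=> e; apply: b_a'; rewrite -e2 -e3 e.
by move=> x /interior_subset.
Qed.
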